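(* Let $\sigma\colon(\mathcal M,L)\to(\mathcal B,\tilde L)$ be a pseudo-Finsler submersion with $L\colon\mathcal A\to\mathbb R$, such that for every $v\in\mathcal A$ the vertical space at $\pi(v)$ is $g_v$-non-degenerate. Let $R$ be the curvature tensor of the Levi-Civita–Chern connection of $(\mathcal M,L)$, let $R^\top,R^\bot$ be the vertical and horizontal curvature tensors, and $\mathbf T,\mathbf A$ the O'Neill tensors of $\sigma$. Then for each admissible $v\in\mathcal A$ with $p=\pi(v)$, and arbitrary $e,h\in T_p\mathcal M$, the following identity of endomorphisms of $T_p\mathcal M$ holds: $$R_v(e,h)=R^\top_v(e,h)+R^\bot_v(e,h)+(\nabla_e(\mathbf T+\mathbf A))^v_h-(\nabla_h(\mathbf T+\mathbf A))^v_e+(\mathbf T+\mathbf A)^v_h(\mathbf T+\mathbf A)^v_e-(\mathbf T+\mathbf A)^v_e(\mathbf T+\mathbf A)^v_h .$$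
   Context: **Metrics.** A pseudo-Finsler metric on $\mathcal M$ (with projection $\pi\colon T\mathcal M\to\mathcal M$) is a smooth $L\colon\mathcal A\to\mathbb R$, $\mathcal A\subset T\mathcal M\setminus\mathbf 0$ open and invariant under positive scalar multiplication, with $L(\lambda v)=\lambda^2L(v)$ for $\lambda>0$ and with non-degenerate fundamental tensor $g_v(e,h)=\frac12\frac{\partial^2}{\partial s\partial t}L(v+se+th)|_{s=t=0}$, $v\in\mathcal A$, $e,h\in T_{\pi(v)}\mathcal M$. Elements of $\mathcal A$ are called admissible; a local vector field $V$ is admissible if it takes values in $\mathcal A$. **Anisotropic calculus.** An anisotropic tensor $T$ assigns smoothly to $v\in\mathcal A$ a tensor $T_v$ (or $T^v$) on $T_{\pi(v)}\mathcal M$; in particular an anisotropic vector field $\mathcal X$ assigns $\mathcal X_v\in T_{\pi(v)}\mathcal M$. $T_V$ is the ordinary tensor $(T_V)_q=T_{V_q}$. Fiber derivative: $(\dot\partial T)_v(e)=(\dot\partial_eT)_v=\frac{d}{dt}T_{v+te}|_{t=0}$. An anisotropic connection assigns to vector fields $E,H$ an anisotropic vector field $\nabla_EH$, $v\mapsto\nabla^v_EH$, $C^\infty$-linear in $E$, additive and satisfying the Leibniz rule in $H$; for admissible $V$, $\nabla^V$ is an affine connection. For anisotropic vector fields $\nabla^v_e\mathcal X=\nabla^v_e(\mathcal X_V)-(\dot\partial\mathcal X)_v(\nabla^v_eV)$, and for functions $f$ on $\mathcal A$, $(\nabla_ef)(v)=e(f(V))-(\dot\partial f)_v(\nabla^v_eV)$,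 for any admissible local extension $V$ of $v$ (independent of the choice); covariant derivatives of other anisotropic tensors are then defined by the product rule. The Levi-Civita–Chern connection of $(\mathcal M,L)$ is the unique anisotropic connection with $\nabla^v_EH-\nabla^v_HE=[E,H]_{\pi(v)}$ and $\nabla g=0$. Its curvature is $R_v(E,H)B=\nabla^v_E\nabla_HB-\nabla^v_H\nabla_EB-\nabla^v_{[E,H]}B$. **Submersions.** Let $\sigma\colon\mathcal M\to\mathcal B$ be a surjective map with surjective differential, $\mathcal V_p=\ker d\sigma_p$ (vertical vectors). An admissible $v\in\mathcal A_p:=\mathcal A\cap T_p\mathcal M$ is horizontal if $g_v(v,w)=0$ for all $w\in\mathcal V_p$. $\sigma\colon(\mathcal M,L)\to(\mathcal B,\tilde L)$ is a pseudo-Finsler submersion if the restriction of $L$ to the tangent spaces of the fibers is a pseudo-Finsler metric on each fiber, and $L(v)=\tilde L(d\sigma(v))$ for every horizontal $v$ (in particular $d\sigma(v)$ is admissible). **O'Neill tensors.** For $v\in\mathcal A_p$, write $e=e^\top_v+e^\bot_v$ with $e^\top_v\in\mathcal V_p$ and $e^\bot_v$ $g_v$-orthogonal to $\mathcal V_p$. For an (anisotropic) vector field $E$, $E^\top,E^\bot$ are the anisotropic vector fields $v\mapsto (E_v)^\top_v$, $v\mapsto (E_v)^\bot_v$. Put $\chi^v_he=(\nabla^v_hE^\bot)^\top_v+(\nabla^v_hE^\top)^\bot_v$ for any extension $E$ of $e$ (this is tensorial), and $\mathbf T^v_be=\chi^v_{b^\top_v}e$, $\mathbf A^v_be=\chi^v_{b^\bot_v}e$,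 so $\chi=\mathbf T+\mathbf A$. **Vertical and horizontal curvature.** For $b,e,h\in T_p\mathcal M$ with extensions $B,E,H$, $R^\top_v(b,e)h=\big(\nabla^v_b(\nabla_EH^\top)^\top-\nabla^v_e(\nabla_BH^\top)^\top-\nabla^v_{[B,E]}H^\top\big)^\top_v$ and $R^\bot_v(b,e)h=\big(\nabla^v_b(\nabla_EH^\bot)^\bot-\nabla^v_e(\nabla_BH^\bot)^\bot-\nabla^v_{[B,E]}H^\bot\big)^\bot_v$; these are anisotropic tensors. *)

(* Defs.v *)
From mathcomp Require Import all_boot all_order all_algebra.
From mathcomp Require Import all_classical all_reals all_analysis.

Set Implicit Arguments.
Unset Strict Implicit.
Unset Printing Implicit Defensive.

Import Order.TTheory GRing.Theory Num.Theory.
Import numFieldNormedType.Exports.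

Local Open Scope classical_set_scope.
Local Open Scope ring_scope.

(* C^k and C^oo maps on open subsets of finite-dimensional normed spaces. *)
Fixpoint Ck (R : realType) (V W : normedModType R) (k : nat) (U : set V)
    (f : V -> W) : Prop :=
  match k with
  | 0 => forall x, U x -> {for x, continuous f}
  | k'.+1 => (forall x, U x -> differentiable f x) /\
             forall v : V, Ck k' U (fun x => 'd f x v)
  end.

Definition smooth_on (R : realType) (V W : normedModType R) (U : set V)
  (f : V -> W) : Prop := forall k, Ck k U f.

(* A Hausdorff second countable smooth n-manifold without boundary.  The atlas
   is indexed by the points: [mchart q] is a chart around q, with domain
   [mdom q] and inverse [mpar q].  Only the values of [mchart q] on [mdom q]
   and of [mpar q] on the image of [mdom q] are meaningful. *)
Record manifold (R : realType) (n : nat) := Manifold {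
  mcarrier :> topologicalType;
  mhausdorff : hausdorff_space mcarrier;
  msecond_countable : @second_countable mcarrier;
  mdom : mcarrier -> set mcarrier;
  mchart : mcarrier -> mcarrier -> 'rV[R]_n;
  mpar : mcarrier -> 'rV[R]_n -> mcarrier;
  mdom_open : forall q, open (mdom q);
  mdom_center : forall q, mdom q q;
  mimage_open : forall q, open (mchart q @` mdom q);
  mchartK : forall q p, mdom q p -> mpar q (mchart q p) = p;
  mchart_continuous : forall q p, mdom q p -> {for p, continuous (mchart q)};
  mpar_continuous : forall q x, (mchart q @` mdom q) x ->
    {for x, continuous (mpar q)};
  mtransition_smooth : forall q r,
    smooth_on (mchart q @` (mdom q `&` mdom r)) (mchart r \o mpar q)
}.

(* T_pM is 'rV_n for every p: a tangent vector at p is given by its components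
   in the chart [mchart p].  A tangent vector is thus a pair (p, u), but the
   topology and smooth structure of TM are not those of the product M * 'rV_n:
   they are read in the charts (x, w) |-> [tpar q (x, w)] below. *)
Definition tangent (R : realType) (n : nat) (M : manifold R n) : Type :=
  (M * 'rV[R]_n)%type.

Section TangentBundle.
Variables (R : realType) (n : nat) (M : manifold R n).
Implicit Types (p q : M) (v : tangent M) (e h : 'rV[R]_n) (U : set M)
  (A : set (tangent M)).

(* components of v in the chart at q *)
Definition tcoord q v : 'rV[R]_n :=
  'd (mchart q \o mpar v.1) (mchart v.1 v.1) (v.2).

(* the tangent vector with components z.2 in the chart at q, at the point with
   coordinates z.1 *)
Definition tpar q (z : ('rV[R]_n * 'rV[R]_n)%type) : tangent M :=
  (mpar q z.1, 'd (mchart (mpar q z.1) \o mpar q) (z.1) (z.2)).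

Definition local_set q U : set 'rV[R]_n := mchart q @` (mdom q `&` U).

Definition local_tset q A : set ('rV[R]_n * 'rV[R]_n)%type :=
  [set z | (mchart q @` mdom q) z.1 /\ A (tpar q z)].

Definition tangent_open A : Prop := forall q, open (local_tset q A).

Definition smooth_fun U (f : M -> R) : Prop :=
  forall q, smooth_on (local_set q U) (f \o mpar q).

Definition smooth_field U (E : M -> 'rV[R]_n) : Prop :=
  forall q, smooth_on (local_set q U)
    (fun x => tcoord q (mpar q x, E (mpar q x))).

Definition aniso_smooth_fun A (f : tangent M -> R) : Prop :=
  forall q, smooth_on (local_tset q A) (f \o tpar q).

Definition aniso_smooth_field A (X : tangent M -> 'rV[R]_n) : Prop :=
  forall q, smooth_on (local_tset q A)
    (fun z => tcoord q ((tpar q z).1, X (tpar q z))).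

(* e(f) for e in T_pM *)
Definition dirder p e (f : M -> R) : R := 'd (f \o mpar p) (mchart p p) e.

(* [E, H]^k = E^i d_i H^k - H^i d_i E^k, in the chart at p *)
Definition bracket (E H : M -> 'rV[R]_n) (p : M) : 'rV[R]_n :=
  'd (fun x => tcoord p (mpar p x, H (mpar p x))) (mchart p p) (E p) -
  'd (fun x => tcoord p (mpar p x, E (mpar p x))) (mchart p p) (H p).

(* The local field around p with constant components in the chart at p and
   value e at p (smooth on [mdom p], junk elsewhere).  It serves as the
   extension of e wherever the value does not depend on the extension. *)
Definition extend p e : M -> 'rV[R]_n :=
  fun q => 'd (mchart q \o mpar p) (mchart p q) e.

Definition fiber_der (W : normedModType R) (f : tangent M -> W) v e : W :=
  derive1 (fun t : R => f (v.1, v.2 + t *: e)) 0.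

Definition fundamental (L : tangent M -> R) v e h : R :=
  2^-1 * derive1 (fun s : R =>
    derive1 (fun t : R => L (v.1, v.2 + s *: e + t *: h)) 0) 0.

Definition nondegenerate_on (W : set 'rV[R]_n)
    (g : 'rV[R]_n -> 'rV[R]_n -> R) : Prop :=
  forall e, W e -> (forall h, W h -> g e h = 0) -> e = 0.

Record pseudo_Finsler (A : set (tangent M)) (L : tangent M -> R) : Prop := {
  pF_nonzero : forall v, A v -> v.2 <> 0;
  pF_open : tangent_open A;
  pF_conic : forall v (l : R), A v -> 0 < l -> A (v.1, l *: v.2);
  pF_smooth : aniso_smooth_fun A L;
  pF_homogeneous : forall v (l : R), A v -> 0 < l ->
    L (v.1, l *: v.2) = l ^+ 2 * L v;
  pF_nondegenerate : forall v, A v -> nondegenerate_on setT (fundamental L v)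
}.

(* A connection acts on local fields: [nabla E H v] is meaningful when v lies in
   A and E, H are smooth on some open neighbourhood of the base point of v, and
   by [ac_local] it depends only on the germs of E and H there. *)
Definition connection : Type :=
  (M -> 'rV[R]_n) -> (M -> 'rV[R]_n) -> tangent M -> 'rV[R]_n.

Record aniso_connection (A : set (tangent M)) (nabla : connection) : Prop := {
  ac_smooth : forall U E H, open U -> smooth_field U E -> smooth_field U H ->
    aniso_smooth_field (A `&` [set v | U v.1]) (nabla E H);
  ac_local : forall U E E' H H', open U -> smooth_field U E ->
    smooth_field U H -> (forall q, U q -> E q = E' q /\ H q = H' q) ->
    forall v, A v -> U v.1 -> nabla E H v = nabla E' H' v;
  ac_linear : forall U f E E' H, open U -> smooth_fun U f ->
    smooth_field U E -> smooth_field U E' -> smooth_field U H ->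
    forall v, A v -> U v.1 ->
    nabla (fun q => f q *: E q + E' q) H v =
      f v.1 *: nabla E H v + nabla E' H v;
  ac_additive : forall U E H H', open U ->
    smooth_field U E -> smooth_field U H -> smooth_field U H' ->
    forall v, A v -> U v.1 ->
    nabla E (fun q => H q + H' q) v = nabla E H v + nabla E H' v;
  ac_Leibniz : forall U f E H, open U -> smooth_fun U f ->
    smooth_field U E -> smooth_field U H ->
    forall v, A v -> U v.1 ->
    nabla E (fun q => f q *: H q) v =
      dirder v.1 (E v.1) f *: H v.1 + f v.1 *: nabla E H v
}.

Section Derivatives.
Variable nabla : connection.

(* nabla^v_e H for a vector e at the base point of v *)
Definition nab v e (H : M -> 'rV[R]_n) : 'rV[R]_n :=
  nabla (extend v.1 e) H v.

(* In both definitions V is an admissible local extension of v. *)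
Definition nab_fun v e (f : tangent M -> R) : R :=
  let V := extend v.1 v.2 in
  dirder v.1 e (fun q => f (q, V q)) - fiber_der f v (nab v e V).

Definition nab_field v e (X : tangent M -> 'rV[R]_n) : 'rV[R]_n :=
  let V := extend v.1 v.2 in
  nab v e (fun q => X (q, V q)) - fiber_der X v (nab v e V).

(* (nabla_e S)^v_h b for an anisotropic (1,2)-tensor S, by the product rule;
   H and B are local fields extending h and b. *)
Definition nab_tensor (S : tangent M -> 'rV[R]_n -> 'rV[R]_n -> 'rV[R]_n)
    v e (H B : M -> 'rV[R]_n) : 'rV[R]_n :=
  nab_field v e (fun w => S w (H w.1) (B w.1))
  - S v (nab v e H) (B v.1) - S v (H v.1) (nab v e B).

Definition curvature (E H B : M -> 'rV[R]_n) v : 'rV[R]_n :=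
  nab_field v (E v.1) (nabla H B) - nab_field v (H v.1) (nabla E B)
  - nab v (bracket E H v.1) B.

End Derivatives.

Record Levi_Civita_Chern (A : set (tangent M)) (L : tangent M -> R)
    (nabla : connection) : Prop := {
  LCC_connection : aniso_connection A nabla;
  LCC_torsion_free : forall U E H, open U ->
    smooth_field U E -> smooth_field U H -> forall v, A v -> U v.1 ->
    nabla E H v - nabla H E v = bracket E H v.1;
  LCC_metric : forall U E H B, open U ->
    smooth_field U E -> smooth_field U H -> smooth_field U B ->
    forall v, A v -> U v.1 ->
    nab_fun nabla v (E v.1) (fun w => fundamental L w (H w.1) (B w.1))
    - fundamental L v (nabla E H v) (B v.1)
    - fundamental L v (H v.1) (nabla E B v) = 0
}.

End TangentBundle.

Section Submersions.
Variables (R : realType) (n m : nat) (M : manifold R n) (N : manifold R m).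
Implicit Types (v : tangent M) (e h b : 'rV[R]_n) (sigma : M -> N).

Definition smooth_map sigma : Prop :=
  continuous sigma /\
  forall q r, smooth_on (local_set q (sigma @^-1` mdom r))
                (mchart r \o sigma \o mpar q).

Definition dmap sigma (p : M) (u : 'rV[R]_n) : 'rV[R]_m :=
  'd (mchart (sigma p) \o sigma \o mpar p) (mchart p p) u.

Definition vertical sigma (p : M) : set 'rV[R]_n :=
  [set u | dmap sigma p u = 0].

Definition horizontal sigma (L : tangent M -> R) v : Prop :=
  forall w, vertical sigma v.1 w -> fundamental L v v.2 w = 0.

(* [ps_fibers]: L restricts to a pseudo-Finsler metric on each fiber.  The
   fiber through p has tangent space [vertical sigma p] at p, so the restricted
   metric has as admissible vectors the vertical elements of A, and its
   fundamental tensor is [fundamental L v] on vertical arguments; smoothness,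
   homogeneity, openness and conicity are inherited from L and A. *)
Record pseudo_Finsler_submersion
    (A : set (tangent M)) (L : tangent M -> R)
    (A' : set (tangent N)) (L' : tangent N -> R) sigma : Prop := {
  ps_total : pseudo_Finsler A L;
  ps_base : pseudo_Finsler A' L';
  ps_smooth : smooth_map sigma;
  ps_surjective : forall y, exists p, sigma p = y;
  ps_dsurjective : forall p u', exists u, dmap sigma p u = u';
  ps_fibers : forall v, A v -> vertical sigma v.1 v.2 ->
    nondegenerate_on (vertical sigma v.1) (fundamental L v);
  ps_isometry : forall v, A v -> horizontal sigma L v ->
    let v' := (sigma v.1, dmap sigma v.1 v.2) in A' v' /\ L v = L' v'
}.

Section ONeill.
Variables (L : tangent M -> R) (sigma : M -> N) (nabla : connection M).

(* the vertical vector w such that e - w is g_v-orthogonal to the vertical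
   space; it exists and is unique when that space is g_v-non-degenerate *)
Definition vpart v e : 'rV[R]_n :=
  xget 0 [set w | vertical sigma v.1 w /\
                  forall u, vertical sigma v.1 u -> fundamental L v (e - w) u = 0].

Definition hpart v e : 'rV[R]_n := e - vpart v e.

Definition vfield (X : tangent M -> 'rV[R]_n) : tangent M -> 'rV[R]_n :=
  fun w => vpart w (X w).

Definition hfield (X : tangent M -> 'rV[R]_n) : tangent M -> 'rV[R]_n :=
  fun w => hpart w (X w).

(* an ordinary vector field as an anisotropic one *)
Definition vlift (E : M -> 'rV[R]_n) : tangent M -> 'rV[R]_n := fun w => E w.1.

Definition chi v h e : 'rV[R]_n :=
  let E := vlift (extend v.1 e) in
  vpart v (nab_field nabla v h (hfield E)) +
  hpart v (nab_field nabla v h (vfield E)).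

Definition ONeillT v b e : 'rV[R]_n := chi v (vpart v b) e.

Definition ONeillA v b e : 'rV[R]_n := chi v (hpart v b) e.

Definition ONeillTA v b e : 'rV[R]_n := ONeillT v b e + ONeillA v b e.

(* nabla_E X as an anisotropic vector field *)
Definition nab_along (E : M -> 'rV[R]_n) (X : tangent M -> 'rV[R]_n) :
  tangent M -> 'rV[R]_n := fun w => nab_field nabla w (E w.1) X.

Definition vcurvature (E H B : M -> 'rV[R]_n) v : 'rV[R]_n :=
  let Bv := vfield (vlift B) in
  vpart v (nab_along E (vfield (nab_along H Bv)) v
           - nab_along H (vfield (nab_along E Bv)) v
           - nab_field nabla v (bracket E H v.1) Bv).

Definition hcurvature (E H B : M -> 'rV[R]_n) v : 'rV[R]_n :=
  let Bh := hfield (vlift B) in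
  hpart v (nab_along E (hfield (nab_along H Bh)) v
           - nab_along H (hfield (nab_along E Bh)) v
           - nab_field nabla v (bracket E H v.1) Bh).

End ONeill.
End Submersions.

(* Main.v *)
Require Import Defs.
From HB Require Import structures.
From mathcomp Require Import all_boot all_order all_algebra.
From mathcomp Require Import all_classical all_reals all_analysis.
From mathcomp Require Import ring.

Set Implicit Arguments.
Unset Strict Implicit.
Unset Printing Implicit Defensive.

Import Order.TTheory GRing.Theory Num.Theory.
Import numFieldNormedType.Exports.

Local Open Scope classical_set_scope.
Local Open Scope ring_scope.

(* Write chi_a b for (T + A)_a b, and P for the vertical projection, Q = 1 - P.
   The split derivative D_a X = P nabla_a (P X) + Q nabla_a (Q X) satisfies
   nabla_a = D_a + chi_a, because chi_a X = P nabla_a (Q X) + Q nabla_a (P X) is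
   tensorial in X: when X vanishes at v, nabla_a commutes there with P and Q.
   The vertical and horizontal curvatures add up to the curvature of D, and
   expanding nabla = D + chi in the commutator gives the identity; the terms
   chi_[E,H], chi_(nabla_E H) and chi_(nabla_H E) cancel as there is no torsion.

   Everything is computed in the chart at the base point of v, where an
   anisotropic field is a function f of z = (x, y), and
     nabla_a f = df(a, - Gamma_z(a, y)) + Gamma_z(a, f z). *)

(** * Differentials and C^k maps *)

(** ['d] and [derive1] are total operators with a meaning only where a derivative exists, and
    [vpart] selects its value by choice. An identity must therefore hold near a point, between
    functions known to be smooth there, before it can be differentiated. For the vertical projection
    this requires smoothness in the direction as well as in the base point, and so an explicit
    formula: it is obtained from the inverse of a matrix whose invertibility is exactly the
    non-degeneracy of the vertical space together with the surjectivity of the differential of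
    sigma. The signs of the quadratic terms come from splitting twice: nabla_e nabla_H B = D_e D_H B
    + chi_e (D_H B) + nabla_e (chi_H B), where D_H B = nabla_H B - chi_H B. Hence chi_e chi_h b
    enters with a minus sign. The remaining chi_e (nabla_h B) is the term that the product rule for
    (nabla_h chi)_e b produces, so after antisymmetrization it completes the derivative of chi in
    the other slot. *)

Section NearDiff.
Variables (R : realType) (V W : normedModType R).
Implicit Types f g : V -> W.

(** Locality of the differential reduces to this case by writing g = f + (g - f), where g - f
    vanishes near x. The remainder in the first-order expansion is then identically zero near x, and
    uniqueness of the expansion identifies ['d]. *)
Lemma near_is_diff0 f x : (\forall y \near x, f y = 0) -> is_diff x f 0.
Proof.
move=> f0.
have fx0 : f x = 0 := nbhs_singleton f0.
have c0 : continuous (\0 : V -> W) by exact: cst_continuous.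
have E : f \o shift x = cst (f x) + \0 +o_ 0 id.
  apply/eqaddoP => _/posnumP[e]; near=> y.
  rewrite !fctE /= fx0 addr0 subr0.
  have -> : f (y + x) = 0; last by rewrite normr0 mulr_ge0.
  by near: y; move: f0; rewrite (near_shift 0) /= subr0.
have D : 'd f x = \0 :> (V -> W) by apply: diff_unique.
by apply: DiffDef => //; apply/diff_locallyP; rewrite D.
Unshelve. all: by end_near. Qed.

Lemma near_eq_is_diff f g x : (\forall y \near x, f y = g y) ->
  differentiable f x -> is_diff x g ('d f x).
Proof.
move=> fg df.
have H : is_diff x (g - f) 0.
  apply: near_is_diff0; apply: filterS fg => y /= E.
  by rewrite !fctE E subrr.
have -> : g = f + (g - f) by rewrite addrC subrK.
have D := is_diffD (differentiableP df) H.
exact: (is_diff_eq D (addr0 _)).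
Qed.

Lemma near_eq_differentiable f g x : (\forall y \near x, f y = g y) ->
  differentiable f x -> differentiable g x.
Proof. by move=> fg df; have [] := near_eq_is_diff fg df. Qed.

Lemma near_eq_diff f g x : (\forall y \near x, f y = g y) ->
  differentiable f x -> 'd g x = 'd f x :> (V -> W).
Proof. by move=> fg df; have [] := near_eq_is_diff fg df. Qed.

End NearDiff.

Section DiffAt.
Variable R : realType.
Implicit Types V W Z : normedModType R.

Lemma diffD_at V W (f g : V -> W) x v : differentiable f x -> differentiable g x ->
  'd (fun y => f y + g y) x v = 'd f x v + 'd g x v.
Proof.
move=> df dg; have E := congr1 (fun h : V -> W => h v) (diffD df dg).
exact: E.
Qed.

Lemma diff_comp_at V W Z (f : V -> W) (g : W -> Z) x v :
  differentiable f x -> differentiable g (f x) ->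
  'd (fun y => g (f y)) x v = 'd g (f x) ('d f x v).
Proof.
move=> df dg; have E := congr1 (fun h : V -> Z => h v) (diff_comp df dg).
exact: E.
Qed.

Lemma diff_lin_at V W Z (f : V -> W) (l : {linear W -> Z}) x v :
  continuous l -> differentiable f x -> 'd (fun y => l (f y)) x v = l ('d f x v).
Proof.
move=> cl df; have E1 := diff_comp_at v df (linear_differentiable (f x) cl).
have E2 := congr1 (fun h : W -> Z => h ('d f x v)) (diff_lin (f x) cl).
exact: etrans E1 E2.
Qed.

Lemma diff_pair_at V W Z (f : V -> W) (g : V -> Z) x v :
  differentiable f x -> differentiable g x ->
  'd (fun y => (f y, g y)) x v = ('d f x v, 'd g x v).
Proof.
move=> df dg; have E := congr1 (fun h : V -> W * Z => h v) (diff_pair df dg).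
exact: E.
Qed.

Lemma diff_id_at V (x v : V) : 'd (fun y : V => y) x v = v.
Proof.
have D : is_diff x (fun y : V => y) (fun y => y) by exact: is_diff_id.
have E := congr1 (fun h : V -> V => h v) (@diff_val _ _ _ _ _ _ _ D).
exact: E.
Qed.

Lemma near_eq_diff_at V W (f g : V -> W) x v : (\forall y \near x, f y = g y) ->
  differentiable f x -> 'd g x v = 'd f x v.
Proof.
move=> N df; have E := congr1 (fun h : V -> W => h v) (near_eq_diff N df).
exact: E.
Qed.

(** [fiber_der] and [fundamental] are written with [derive1] along lines; this turns them into
    values of ['d], where the chain and product rules are available. *)
Lemma derive1_line V W (f : V -> W) x u : differentiable f x ->
  derive1 (fun t : R => f (x + t *: u)) 0 = 'd f x u.
Proof.
move=> df; rewrite -(deriveE u df) /derive1 /derive; congr (lim _).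
have -> : (fun h : R => h^-1 *: (f (x + (h + 0) *: u) - f (x + 0 *: u))) =
    (fun h : R => h^-1 *: ((f \o shift x) (h *: u) - f x)); last by [].
by apply: funext => h /=; rewrite !addr0 scale0r addr0 [x + _]addrC.
Qed.

End DiffAt.

Section Scale.
Variables (R : realType) (V W : normedModType R).

(** Registering scaling as a bilinear map reduces the product rule to the differential of a
    continuous bilinear map. *)
Lemma scale_is_bilinear :
  bilinear_for
    (GRing.Scale.Law.clone _ _ *:%R _) (GRing.Scale.Law.clone _ _ *:%R _)
    (@GRing.scale R W : R -> W -> W).
Proof.
split=> [u'|u] a x y /=.
- by rewrite scalerDl scalerA.
- by rewrite scalerDr !scalerA mulrC.
Qed.

HB.instance Definition _ :=
  bilinear_isBilinear.Build R R W W _ _ (@GRing.scale R W) scale_is_bilinear.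

Lemma is_diff_scale (f : V -> R) (g : V -> W) x :
  differentiable f x -> differentiable g x ->
  is_diff x (fun y => f y *: g y) (fun v => f x *: 'd g x v + 'd f x v *: g x).
Proof.
move=> df dg.
have cB : continuous (fun p : R * W => p.1 *: p.2) by exact: scale_continuous.
have dp := differentiable_pair df dg.
have db := differentiable_bilin (f := @GRing.scale R W) (f x, g x) cB.
apply: DiffDef; first exact: (differentiable_comp dp db).
rewrite (diff_comp dp db); apply: funext => v /=.
by rewrite (diff_bilin (f := @GRing.scale R W) (f x, g x) cB) /= (diff_pair df dg).
Qed.
End Scale.

Section Ck.
Variable R : realType.
Implicit Types V W Z : normedModType R.

Lemma Ck_sub V W k (U U' : set V) (f : V -> W) : U' `<=` U -> Ck k U f -> Ck k U' f.
Proof.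
elim: k f => [|k IH] f sU /=; first by move=> H x /sU /H.
by case=> H1 H2; split=> [x /sU /H1 //|v]; apply: IH.
Qed.

Lemma CkS V W k (U : set V) (f : V -> W) : Ck k.+1 U f -> Ck k U f.
Proof.
elim: k f => [|k IH] f [H1 H2]; first by move=> x /H1 /differentiable_continuous.
by split=> // v; apply: IH.
Qed.

Lemma Ck_ext V W k (U : set V) (f g : V -> W) : open U ->
  (forall x, U x -> f x = g x) -> Ck k U f -> Ck k U g.
Proof.
move=> oU; elim: k f g => [|k IH] f g fg /=.
  move=> cf x Ux.
  have N : \forall y \near x, f y = g y by apply: filterS (open_nbhs_nbhs (conj oU Ux)).
  rewrite /prop_for /continuous_at -(nbhs_singleton N).
  apply: cvg_trans (cf x Ux); apply: near_eq_cvg; by apply: filterS N => y ->.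
case=> H1 H2.
have N x : U x -> \forall y \near x, f y = g y.
  by move=> Ux; apply: filterS (open_nbhs_nbhs (conj oU Ux)).
split=> [x Ux|v]; first exact: near_eq_differentiable (N x Ux) (H1 x Ux).
apply: (IH (fun x => 'd f x v)) (H2 v) => x Ux.
exact/esym/(congr1 (fun h : V -> W => h v) (near_eq_diff (N x Ux) (H1 x Ux))).
Qed.

Lemma Ck_cst V W k (U : set V) (a : W) : Ck k U (fun=> a).
Proof.
elim: k a => [|k IH] a; first by move=> x _; exact: cvg_cst.
split=> [x _|v]; first exact: differentiable_cst.
have -> : (fun x : V => 'd (fun=> a) x v) = fun=> 0; last exact: IH.
by apply: funext => x; rewrite (diff_cst a).
Qed.

Lemma Ck_add V W k (U : set V) (f g : V -> W) : open U ->
  Ck k U f -> Ck k U g -> Ck k U (fun x => f x + g x).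
Proof.
move=> oU; elim: k f g => [|k IH] f g.
  by move=> cf cg x Ux; apply: continuousD; [exact: cf|exact: cg].
move=> [f1 f2] [g1 g2]; split=> [x Ux|v].
  by apply: differentiableD; [exact: f1|exact: g1].
apply: (Ck_ext (f := fun x => 'd f x v + 'd g x v)) => // [x Ux|]; last exact: IH (f2 v) (g2 v).
exact/esym/(congr1 (fun h : V -> W => h v) (diffD (f1 x Ux) (g1 x Ux))).
Qed.

Lemma Ck_scale V W k (U : set V) (f : V -> R) (g : V -> W) : open U ->
  Ck k U f -> Ck k U g -> Ck k U (fun x => f x *: g x).
Proof.
move=> oU; elim: k f g => [|k IH] f g.
  by move=> cf cg x Ux; apply: continuousZ; [exact: cf|exact: cg].
move=> Cf Cg; have [f1 f2] := Cf; have [g1 g2] := Cg.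
have H x : U x -> is_diff x (fun y => f y *: g y)
    (fun v => f x *: 'd g x v + 'd f x v *: g x).
  by move=> Ux; apply: is_diff_scale; [exact: f1|exact: g1].
split=> [x /H[] //|v].
apply: (Ck_ext (f := fun x => f x *: 'd g x v + 'd f x v *: g x)) => // [x Ux|].
  exact/esym/(congr1 (fun h : V -> W => h v) (@diff_val _ _ _ _ _ _ _ (H x Ux))).
by apply: Ck_add => //; [exact: IH (CkS Cf) (g2 v)|exact: IH (f2 v) (CkS Cg)].
Qed.

Lemma Ck_lin V W Z k (U : set V) (f : V -> W) (l : {linear W -> Z}) : open U ->
  continuous l -> Ck k U f -> Ck k U (fun x => l (f x)).
Proof.
move=> oU cl; elim: k f => [|k IH] f.
  by move=> cf x Ux; apply: continuous_comp; [exact: cf|exact: cl].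
move=> [f1 f2]; split=> [x Ux|v].
  by apply: (differentiable_comp (f1 x Ux)); exact: linear_differentiable.
apply: (Ck_ext (f := fun x => l ('d f x v))) => // [x Ux|]; last exact: IH (f2 v).
rewrite (diff_comp (f1 x Ux) (linear_differentiable (f x) cl)) /=.
by rewrite diff_lin.
Qed.

Lemma Ck_sum V W k (U : set V) (I : Type) (r : seq I) (P : pred I) (F : I -> V -> W) :
  open U -> (forall i, Ck k U (F i)) -> Ck k U (fun x => \sum_(i <- r | P i) F i x).
Proof.
move=> oU H; elim: r => [|i r IH].
  by have -> : (fun x => \sum_(i <- [::] | P i) F i x) = (fun=> 0 : W);
    [apply: funext => x; rewrite big_nil|exact: Ck_cst].
case Pi : (P i); last first.
  by under eq_fun do rewrite big_cons Pi.
under eq_fun do rewrite big_cons Pi; exact: Ck_add.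
Qed.

(** The family serves to expand a direction that varies with the point in fixed directions [b i].
    The forms are continuous so that [Ck_lin] applies to the coefficients. *)
Definition coordinates V (I : finType) (b : I -> V) (c : I -> {linear V -> R}) :=
  (forall i, continuous (c i)) /\ forall v, v = \sum_i c i v *: b i.

Definition findim V := exists (I : finType) (b : I -> V) (c : I -> {linear V -> R}),
  coordinates b c.

(** [Ck k.+1] controls ['d g] only in fixed directions, while the chain rule evaluates it in the
    moving direction ['d f x v]. Finite dimension of W turns this into a finite sum of products, to
    which the induction hypothesis applies. *)
Lemma Ck_comp V W Z k (U : set V) (U' : set W) (f : V -> W) (g : W -> Z) :
  findim W -> open U -> open U' -> (forall x, U x -> U' (f x)) ->
  Ck k U f -> Ck k U' g -> Ck k U (fun x => g (f x)).
Proof.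
move=> [I [b [c [cc bc]]]] oU oU' sU; elim: k g => [|k IH] g.
  by move=> cf cg x Ux; apply: continuous_comp; [exact: cf|apply: cg; exact: sU].
move=> Cf Cg; have [f1 f2] := Cf; have [g1 g2] := Cg.
split=> [x Ux|v]; first exact: (differentiable_comp (f1 x Ux) (g1 _ (sU _ Ux))).
apply: (Ck_ext (f := fun x => \sum_i c i ('d f x v) *: 'd g (f x) (b i))) => //.
  move=> x Ux; rewrite (diff_comp (f1 x Ux) (g1 _ (sU _ Ux))) /= [X in 'd g _ X]bc.
  by rewrite linear_sum; apply: eq_bigr => i _; rewrite linearZ.
apply: Ck_sum => // i; apply: Ck_scale => //; first by apply: Ck_lin => //; exact: f2.
by apply: IH (CkS Cf) (g2 _).
Qed.

Lemma Ck_pair V W Z k (U : set V) (f : V -> W) (g : V -> Z) : open U ->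
  Ck k U f -> Ck k U g -> Ck k U (fun x => (f x, g x)).
Proof.
move=> oU; elim: k f g => [|k IH] f g.
  by move=> cf cg x Ux; apply: cvg_pair; [exact: cf|exact: cg].
move=> [f1 f2] [g1 g2]; split=> [x Ux|v]; first by apply: differentiable_pair; [exact: f1|exact: g1].
apply: (Ck_ext (f := fun x => ('d f x v, 'd g x v))) => // [x Ux|];
  last exact: IH (f2 v) (g2 v).
by rewrite (diff_pair (f1 x Ux) (g1 x Ux)).
Qed.

Lemma Ck_inv V k (U : set V) (f : V -> R) : open U -> (forall x, U x -> f x != 0) ->
  Ck k U f -> Ck k U (fun x => (f x)^-1).
Proof.
move=> oU f0; elim: k => [|k IH].
  by move=> cf x Ux; apply: cvgV; [exact: f0|exact: cf].
move=> Cf; have [f1 f2] := Cf.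
split=> [x Ux|v].
  by apply: differentiableV; [exact: f1|exact: f0].
apply: (Ck_ext (f := fun x => (- ((f x)^-1 * (f x)^-1)) *: 'd f x v)) => //.
  move=> x Ux; rewrite -invfM -expr2.
  exact/esym/(congr1 (fun h : V -> R => h v) (diffV (f1 x Ux) (f0 x Ux))).
apply: Ck_scale => //; last first.
  exact: (f2 v).
have {}IH := IH (CkS Cf).
apply: (Ck_ext (f := fun x => (-1 : R) *: ((f x)^-1 *: (f x)^-1))) => //.
  by move=> x Ux; rewrite scaleN1r.
by apply: Ck_scale => //; [exact: Ck_cst|exact: (Ck_scale oU IH IH)].
Qed.

End Ck.

(** * Germs of smooth maps *)

Section SmoothAt.
Variable R : realType.
Implicit Types V W Z : normedModType R.

Lemma Ck_local V W k (U : set V) (f : V -> W) :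
  (forall x, U x -> exists2 U', open U' /\ U' x & Ck k U' f) -> Ck k U f.
Proof.
elim: k f => [|k IH] f H.
  by move=> x /H [U' [_ U'x]]; apply.
split=> [x /H [U' [_ U'x] []] H1 _|v]; first exact: H1.
by apply: IH => x /H [U' oU' [_ H2]]; exists U'; last exact: H2.
Qed.

(** One neighbourhood serves all orders k, which makes the property open in x and stable under
    differentiation. *)
Definition smooth_at V W (f : V -> W) (x : V) :=
  exists2 U, open U /\ U x & smooth_on U f.

Lemma smooth_on_at V W (U : set V) (f : V -> W) x :
  open U -> U x -> smooth_on U f -> smooth_at f x.
Proof. by move=> oU Ux sf; exists U. Qed.

Lemma smooth_at_on V W (U : set V) (f : V -> W) :
  (forall x, U x -> smooth_at f x) -> smooth_on U f.
Proof. by move=> H k; apply: Ck_local => x /H [U' ? sf]; exists U'. Qed.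

Lemma near_open (T : topologicalType) (U : set T) x : open U -> U x -> \forall y \near x, U y.
Proof. by move=> oU Ux; exact: open_nbhs_nbhs. Qed.

Lemma smooth_at_near V W (f : V -> W) x :
  smooth_at f x -> \forall y \near x, smooth_at f y.
Proof.
by move=> [U [oU Ux] sf]; near=> y; exists U => //; split => //; near: y; exact: near_open.
Unshelve. all: by end_near. Qed.

Lemma smooth_at_ext V W (f g : V -> W) x : (\forall y \near x, f y = g y) ->
  smooth_at f x -> smooth_at g x.
Proof.
move=> fg [U [oU Ux] sf].
exists (U `&` interior [set y | f y = g y]).
  split; first by apply: openI => //; exact: open_interior.
  by split.
move=> k; apply: (@Ck_ext _ _ _ _ _ f).
- by apply: openI => //; exact: open_interior.
- by move=> y [_ /interior_subset].
- by apply: Ck_sub (sf k) => y [].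
Qed.

Lemma smooth_at_differentiable V W (f : V -> W) x : smooth_at f x -> differentiable f x.
Proof. by move=> [U [oU Ux] /(_ 1%N) [H _]]; exact: H. Qed.

Lemma smooth_at_continuous V W (f : V -> W) x : smooth_at f x -> {for x, continuous f}.
Proof. by move=> /smooth_at_differentiable/differentiable_continuous. Qed.

Lemma smooth_at_diff V W (f : V -> W) x v : smooth_at f x ->
  smooth_at (fun y => 'd f y v) x.
Proof. by move=> [U Ux sf]; exists U => // k; have [_] := sf k.+1; apply. Qed.

Lemma smooth_at_cst V W (a : W) (x : V) : smooth_at (fun=> a) x.
Proof.
exists setT; first by split => //; exact: openT.
by move=> k; exact: Ck_cst.
Qed.

Lemma smooth_at_add V W (f g : V -> W) x : smooth_at f x -> smooth_at g x ->
  smooth_at (fun y => f y + g y) x.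
Proof.
move=> [U [oU Ux] sf] [U' [oU' Ux'] sg].
have oI := openI oU oU'.
exists (U `&` U') => [|k]; first by [].
by apply: Ck_add => //; [apply: Ck_sub (sf k)|apply: Ck_sub (sg k)] => y [].
Qed.

Lemma smooth_at_scale V W (f : V -> R) (g : V -> W) x : smooth_at f x -> smooth_at g x ->
  smooth_at (fun y => f y *: g y) x.
Proof.
move=> [U [oU Ux] sf] [U' [oU' Ux'] sg].
have oI := openI oU oU'.
exists (U `&` U') => [|k]; first by [].
by apply: Ck_scale => //; [apply: Ck_sub (sf k)|apply: Ck_sub (sg k)] => y [].
Qed.

Lemma smooth_at_pair V W Z (f : V -> W) (g : V -> Z) x : smooth_at f x -> smooth_at g x ->
  smooth_at (fun y => (f y, g y)) x.
Proof.
move=> [U [oU Ux] sf] [U' [oU' Ux'] sg].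
have oI := openI oU oU'.
exists (U `&` U') => [|k]; first by [].
by apply: Ck_pair => //; [apply: Ck_sub (sf k)|apply: Ck_sub (sg k)] => y [].
Qed.

Lemma smooth_at_lin V W Z (l : {linear W -> Z}) (f : V -> W) x : continuous l ->
  smooth_at f x -> smooth_at (fun y => l (f y)) x.
Proof. by move=> cl [U [oU Ux] sf]; exists U => // k; exact: Ck_lin. Qed.

Lemma smooth_at_id V (x : V) : smooth_at (fun y => y) x.
Proof.
exists setT; first by split => //; exact: openT.
case=> [|k]; first by move=> y _; exact: cvg_id.
have D y : is_diff y (fun y : V => y) (fun y => y) by exact: is_diff_id.
split=> [y _|v]; first by have [] := D y.
apply: (@Ck_ext _ _ _ _ _ (fun=> v)); [exact: openT| |exact: Ck_cst].
move=> y _; exact/esym/(congr1 (fun h : V -> V => h v) (@diff_val _ _ _ _ _ _ _ (D y))).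
Qed.

Lemma smooth_at_linear V W (l : {linear V -> W}) x : continuous l -> smooth_at l x.
Proof. by move=> cl; exact: smooth_at_lin (smooth_at_id x). Qed.

Lemma smooth_at_sum V W (I : Type) (r : seq I) (P : pred I) (F : I -> V -> W) x :
  (forall i, smooth_at (F i) x) -> smooth_at (fun y => \sum_(i <- r | P i) F i y) x.
Proof.
move=> H; elim: r => [|i r IH].
  by under eq_fun do rewrite big_nil; exact: smooth_at_cst.
case Pi : (P i); last first.
  by under eq_fun do rewrite big_cons Pi.
by under eq_fun do rewrite big_cons Pi; exact: smooth_at_add.
Qed.

Lemma smooth_at_comp V W Z (f : V -> W) (g : W -> Z) x : findim W ->
  smooth_at f x -> smooth_at g (f x) -> smooth_at (fun y => g (f y)) x.
Proof.
move=> fdW [U [oU Ux] sf] [U' [oU' U'fx] sg].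
(* Order 0 of smoothness is continuity, which makes this preimage open. *)
have o : open (U `&` f @^-1` U').
  rewrite openE => y [Uy U'fy]; apply: filterI; first exact: near_open.
  exact: (sf 0%N y Uy) (near_open oU' U'fy).
exists (U `&` f @^-1` U') => // k.
apply: (Ck_comp fdW o oU' _ _ (sg k)) => [y []//|].
by apply: Ck_sub (sf k) => y [].
Qed.

Lemma smooth_at_inv V (f : V -> R) x : f x != 0 -> smooth_at f x ->
  smooth_at (fun y => (f y)^-1) x.
Proof.
move=> fx0 sfx; have [U [oU Ux] sf] := sfx.
have o : open (U `&` f @^-1` [set y | y != 0]).
  rewrite openE => y [Uy fy]; apply: filterI; first exact: near_open.
  exact: (sf 0%N y Uy) (near_open (@open_neq R 0) fy).
exists (U `&` f @^-1` [set y | y != 0]) => // k.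
apply: Ck_inv => // [y []//|].
by apply: Ck_sub (sf k) => y [].
Qed.

Lemma smooth_at_mul V (f g : V -> R) x : smooth_at f x -> smooth_at g x ->
  smooth_at (fun y => f y * g y) x.
Proof. exact: smooth_at_scale. Qed.

Lemma smooth_at_prod V (I : Type) (r : seq I) (P : pred I) (F : I -> V -> R) x :
  (forall i, smooth_at (F i) x) -> smooth_at (fun y => \prod_(i <- r | P i) F i y) x.
Proof.
move=> H; elim: r => [|i r IH].
  by under eq_fun do rewrite big_nil; exact: smooth_at_cst.
case Pi : (P i); last first.
  by under eq_fun do rewrite big_cons Pi.
by under eq_fun do rewrite big_cons Pi; exact: smooth_at_mul.
Qed.

Lemma smooth_at_opp V W (f : V -> W) x : smooth_at f x -> smooth_at (fun y => - f y) x.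
Proof.
by move=> sf; under eq_fun do rewrite -scaleN1r;
  apply: smooth_at_scale sf; exact: smooth_at_cst.
Qed.

Lemma smooth_at_sub V W (f g : V -> W) x : smooth_at f x -> smooth_at g x ->
  smooth_at (fun y => f y - g y) x.
Proof. by move=> sf sg; apply: smooth_at_add => //; exact: smooth_at_opp. Qed.

Lemma smooth_at_diff_var V W (f : V -> W) (g : V -> V) x : findim V ->
  smooth_at f x -> smooth_at g x -> smooth_at (fun y => 'd f y (g y)) x.
Proof.
move=> [I [b [c [cc bc]]]] sf sg.
under eq_fun => y do rewrite [g y]bc linear_sum.
apply: smooth_at_sum => i; under eq_fun => y do rewrite linearZ.
by apply: smooth_at_scale; [exact: smooth_at_lin|exact: smooth_at_diff].
Qed.

(** A matrix entry is named as a function in order to carry a linear structure, as [Ck_lin] and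
    [diff_lin_at] require. *)
Definition mxcoord m n i j (A : 'M[R]_(m, n)) : R := A i j.

Fact mxcoord_is_linear m n i j : linear (@mxcoord m n i j).
Proof. by move=> a A B; rewrite /mxcoord !mxE. Qed.

HB.instance Definition _ m n i j :=
  GRing.isLinear.Build R 'M[R]_(m, n) R _ (@mxcoord m n i j) (@mxcoord_is_linear m n i j).

Lemma mxcoord_continuous m n i j : continuous (@mxcoord m n i j).
Proof. exact: coord_continuous. Qed.

Lemma smooth_mx V m n (F : V -> 'M[R]_(m, n)) x :
  (forall i j, smooth_at (fun y => F y i j) x) -> smooth_at F x.
Proof.
move=> H.
have -> : F = fun y => \sum_i \sum_j F y i j *: delta_mx i j.
  by apply: funext => y; exact: matrix_sum_delta.
apply: smooth_at_sum => i; apply: smooth_at_sum => j.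
by apply: smooth_at_scale => //; exact: smooth_at_cst.
Qed.

Lemma smooth_mxcoord V m n (F : V -> 'M[R]_(m, n)) x i j :
  smooth_at F x -> smooth_at (fun y => F y i j) x.
Proof. by move=> H; apply: (smooth_at_lin (l := @mxcoord m n i j)) H; exact: mxcoord_continuous. Qed.

Lemma findim_rV n : findim 'rV[R]_n.
Proof.
exists 'I_n, (fun i => delta_mx 0 i), (fun i => @mxcoord 1 n 0 i); split.
  by move=> i; exact: mxcoord_continuous.
by move=> v; rewrite [LHS]row_sum_delta.
Qed.

Lemma findim_pair V W : findim V -> findim W -> findim (V * W)%type.
Proof.
move=> [I [b [c [cc bc]]]] [J [b' [c' [cc' bc']]]].
exists (I + J)%type, (fun k => match k with inl i => (b i, 0) | inr j => (0, b' j) end),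
  (fun k => match k with inl i => (c i \o fst) : {linear (V * W)%type -> R}
    | inr j => (c' j \o snd) : {linear (V * W)%type -> R} end); split.
  by case=> i /= x; apply: continuous_comp; [exact: cvg_fst|exact: cc|exact: cvg_snd|exact: cc'].
move=> [v w]; rewrite big_sumType /=.
have S (K : finType) (F : K -> (V * W)%type) :
    \sum_k F k = (\sum_k (F k).1, \sum_k (F k).2).
  by elim/big_rec3: _ => // k x y _ _ ->.
have E1 : \sum_i c i v *: ((b i, 0) : (V * W)%type) = (v, 0).
  rewrite S /=; congr (_, _); first by rewrite -bc.
  by rewrite big1 // => i _; rewrite scaler0.
have E2 : \sum_i c' i w *: ((0, b' i) : (V * W)%type) = (0, w).
  rewrite S /=; congr (_, _); last by rewrite -bc'.
  by rewrite big1 // => i _; rewrite scaler0.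
apply: (@etrans _ _ ((v, 0) + (0, w) : (V * W)%type)).
  by congr (_, _); rewrite ?addr0 ?add0r.
exact: (f_equal2 +%R (esym E1) (esym E2)).
Qed.

End SmoothAt.

(** * Charts *)

Section Charts.
Variables (R : realType) (n : nat) (M : manifold R n).
Implicit Types (p q r s t : M) (U : set M) (F G : M -> 'rV[R]_n) (u : 'rV[R]_n).

Lemma mem_local_set q U x :
  local_set q U x <-> (mchart q @` mdom q) x /\ U (mpar q x).
Proof.
split=> [[r [qr Ur] <-]|[[r qr <-]]].
  by split; [exists r|rewrite mchartK].
by rewrite mchartK // => Ur; exists r.
Qed.

Lemma local_set_chart q r U : mdom q r -> U r -> local_set q U (mchart q r).
Proof. by move=> qr Ur; exists r. Qed.

Lemma local_set_open q U : open U -> open (local_set q U).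
Proof.
move=> oU; rewrite openE => x /mem_local_set [qx Ux].
have N := mpar_continuous qx (near_open oU Ux).
have N' := near_open (@mimage_open _ _ _ q) qx.
rewrite /interior; near=> y; apply/mem_local_set; split; near: y; [exact: N'|exact: N].
Unshelve. all: by end_near. Qed.

Lemma near_chart q r U : open U -> mdom q r -> U r ->
  \forall x \near mchart q r, mdom q (mpar q x) /\ U (mpar q x) /\ mchart q (mpar q x) = x.
Proof.
move=> oU qr Ur.
have N := near_open (local_set_open (q := q) oU) (local_set_chart qr Ur).
by apply: filterS N => _ [s [qs Us] <-]; rewrite mchartK.
Qed.

(* components in the chart at s of the vector with components u in the chart at q *)
Definition trans q s r u : 'rV[R]_n := 'd (mchart s \o mpar q) (mchart q r) u.

Lemma transition_smooth_at q s r : mdom q r -> mdom s r ->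
  smooth_at (mchart s \o mpar q) (mchart q r).
Proof.
move=> qr sr; apply: smooth_on_at (mtransition_smooth q s).
  by exact: local_set_open (mdom_open s).
exact: local_set_chart.
Qed.

(** The cocycle rule of the tangent bundle: near r the transition from q to t factors through the
    chart at s, and the chain rule applies. *)
Lemma trans_comp q s t r u : mdom q r -> mdom s r -> mdom t r ->
  trans s t r (trans q s r u) = trans q t r u.
Proof.
move=> qr sr tr.
have d1 := smooth_at_differentiable (transition_smooth_at qr sr).
have E : (mchart s \o mpar q) (mchart q r) = mchart s r by rewrite /= mchartK.
have d2 : differentiable (mchart t \o mpar s) ((mchart s \o mpar q) (mchart q r)).
  by rewrite E; exact: smooth_at_differentiable (transition_smooth_at sr tr).
have d3 := smooth_at_differentiable (transition_smooth_at qr tr).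
have N : \forall x \near mchart q r,
    (mchart t \o mpar q) x = ((mchart t \o mpar s) \o (mchart s \o mpar q)) x.
  apply: filterS (near_chart (mdom_open s) qr sr) => x /= [_ [sx _]].
  by rewrite mchartK.
have E1 := congr1 (fun h : 'rV[R]_n -> 'rV[R]_n => h u) (near_eq_diff N d3).
have E2 := congr1 (fun h : 'rV[R]_n -> 'rV[R]_n => h u) (diff_comp d1 d2).
apply: etrans _ E1; apply: etrans _ (esym E2).
have E3 := congr1 (fun y : 'rV[R]_n => 'd (mchart t \o mpar s) y (trans q s r u)) (esym E).
exact: E3.
Qed.

Lemma trans_id q r u : mdom q r -> trans q q r u = u.
Proof.
move=> qr.
have N : \forall x \near mchart q r, x = (mchart q \o mpar q) x.
  by apply: filterS (near_chart (mdom_open q) qr qr) => x /= [_ [_ ->]].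
have D : is_diff (mchart q r) (fun x : 'rV[R]_n => x) (fun x => x) by exact: is_diff_id.
have E1 := congr1 (fun h : 'rV[R]_n -> 'rV[R]_n => h u) (near_eq_diff N (@ex_diff _ _ _ _ _ _ _ D)).
have E2 := congr1 (fun h : 'rV[R]_n -> 'rV[R]_n => h u) (@diff_val _ _ _ _ _ _ _ D).
exact: etrans E1 E2.
Qed.

Lemma transK q s r u : mdom q r -> mdom s r -> trans s q r (trans q s r u) = u.
Proof. by move=> qr sr; rewrite trans_comp // trans_id. Qed.

Lemma tcoordE q v : tcoord q v = trans v.1 q v.1 v.2.
Proof. by []. Qed.

Lemma tparE p r u : mdom p r -> tpar p (mchart p r, u) = (r, trans p r r u).
Proof. by move=> pr; rewrite /tpar /= mchartK. Qed.

(** The local representative of F, which is precisely the function that [smooth_field] tests in the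
    chart at p. *)
Definition fhat p F x := tcoord p (mpar p x, F (mpar p x)).

Lemma fhat_chart p F r : mdom p r -> fhat p F (mchart p r) = trans r p r (F r).
Proof. by move=> pr; rewrite /fhat mchartK. Qed.

Lemma smooth_field_at p U F r : open U -> smooth_field U F -> mdom p r -> U r ->
  smooth_at (fhat p F) (mchart p r).
Proof.
move=> oU sF pr Ur; apply: smooth_on_at (sF p); first exact: local_set_open.
exact: local_set_chart.
Qed.

(** A single chart is enough: the representative in another chart is the one at p, precomposed with
    the transition map and multiplied by the derivative of the inverse transition. *)
Lemma smooth_fieldP p U F : open U -> U `<=` mdom p ->
  (forall r, U r -> smooth_at (fhat p F) (mchart p r)) -> smooth_field U F.
Proof.
move=> oU sU H q; apply: smooth_at_on => _ [r [qr Ur] <-].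
have pr := sU _ Ur.
have sT := transition_smooth_at qr pr.
apply: (smooth_at_ext (f := fun x => (fun y => 'd (mchart q \o mpar p) y (fhat p F y))
    ((mchart p \o mpar q) x))).
  apply: filterS (near_chart oU qr Ur) => x [qx [Ux _]] /=; have px := sU _ Ux.
  rewrite fhat_chart // tcoordE /=.
  by apply: trans_comp => //; exact: mdom_center.
apply: (smooth_at_comp (f := mchart p \o mpar q)
  (g := fun y => 'd (mchart q \o mpar p) y (fhat p F y)) (findim_rV _ _) sT).
have -> : (mchart p \o mpar q) (mchart q r) = mchart p r by rewrite /= mchartK.
apply: smooth_at_diff_var; [exact: findim_rV| |exact: H].
exact: transition_smooth_at.
Qed.

Lemma smooth_funP p U (f : M -> R) : open U -> U `<=` mdom p ->
  (forall r, U r -> smooth_at (f \o mpar p) (mchart p r)) -> smooth_fun U f.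
Proof.
move=> oU sU H q; apply: smooth_at_on => _ [r [qr Ur] <-].
have pr := sU _ Ur.
have sT := transition_smooth_at qr pr.
apply: (smooth_at_ext (f := fun x => (f \o mpar p) ((mchart p \o mpar q) x))).
  apply: filterS (near_chart oU qr Ur) => x [qx [Ux _]] /=; have px := sU _ Ux.
  by rewrite mchartK.
apply: (smooth_at_comp (f := mchart p \o mpar q) (g := f \o mpar p) (findim_rV _ _) sT).
have -> : (mchart p \o mpar q) (mchart q r) = mchart p r by rewrite /= mchartK.
exact: H.
Qed.

Lemma fhat_extend p q r u : mdom p r -> mdom q r ->
  fhat p (extend q u) (mchart p r) = trans q p r u.
Proof. by move=> pr qr; rewrite fhat_chart // /extend; apply: trans_comp => //; exact: mdom_center. Qed.

Lemma extend_smooth q u : smooth_field (mdom q) (extend q u).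
Proof.
apply: (@smooth_fieldP q); [exact: mdom_open|by []|move=> r qr].
apply: (smooth_at_ext (f := fun=> u)); last exact: smooth_at_cst.
apply: filterS (near_chart (mdom_open q) qr qr) => x [qx [_ <-]].
by rewrite fhat_extend // trans_id.
Qed.

Lemma extend_center q u : extend q u q = u.
Proof. by apply: trans_id; exact: mdom_center. Qed.

End Charts.

HB.instance Definition _ (R : realType) n (M : manifold R n) (q s r : M) :=
  GRing.isLinear.Build R 'rV[R]_n 'rV[R]_n _ (trans q s r)
    (@GRing.linearP _ _ _ _ ('d (mchart s \o mpar q) (mchart q r))).

(** * Vector fields as combinations of coordinate fields *)

Section ConnectionInChart.
Variables (R : realType) (n : nat) (M : manifold R n).
Implicit Types (p q r : M) (U : set M) (F G : M -> 'rV[R]_n) (f : M -> R).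

Lemma smooth_fieldE U F : open U ->
  smooth_field U F <->
  forall q r, mdom q r -> U r -> smooth_at (fhat q F) (mchart q r).
Proof.
move=> oU; split=> [sF q r qr Ur|H q]; first exact: smooth_field_at sF qr Ur.
by apply: smooth_at_on => _ [r [qr Ur] <-]; exact: H.
Qed.

Lemma smooth_fun_at U f q r : open U -> smooth_fun U f -> mdom q r -> U r ->
  smooth_at (f \o mpar q) (mchart q r).
Proof.
move=> oU sf qr Ur; apply: smooth_on_at (sf q); first exact: local_set_open.
exact: local_set_chart.
Qed.

Lemma smooth_field_sub U U' F : U' `<=` U -> smooth_field U F -> smooth_field U' F.
Proof.
move=> sU sF q k; apply: Ck_sub (sF q k) => _ [r [qr U'r] <-].
by apply: local_set_chart => //; exact: sU.
Qed.

Lemma smooth_field_add U F G : open U -> smooth_field U F -> smooth_field U G ->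
  smooth_field U (fun q => F q + G q).
Proof.
move=> oU sF sG; apply/smooth_fieldE => // q r qr Ur.
have -> : fhat q (fun q => F q + G q) = fun x => fhat q F x + fhat q G x.
  by apply: funext => x; rewrite /fhat !tcoordE /= linearD.
by apply: smooth_at_add; [exact: smooth_field_at sF qr Ur|exact: smooth_field_at sG qr Ur].
Qed.

Lemma smooth_field_scale U f F : open U -> smooth_fun U f -> smooth_field U F ->
  smooth_field U (fun q => f q *: F q).
Proof.
move=> oU sf sF; apply/smooth_fieldE => // q r qr Ur.
have -> : fhat q (fun q => f q *: F q) = fun x => f (mpar q x) *: fhat q F x.
  by apply: funext => x; rewrite /fhat !tcoordE /= linearZ.
apply: smooth_at_scale; last exact: smooth_field_at sF qr Ur.
exact: smooth_fun_at sf qr Ur.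
Qed.

Lemma smooth_field0 U : smooth_field U (fun=> 0).
Proof.
move=> q k; have -> : (fun x => tcoord q (mpar q x, 0)) = fun=> 0.
  by apply: funext => x; rewrite !tcoordE /= linear0.
exact: Ck_cst.
Qed.

Lemma smooth_field_sum U (I : Type) (s : seq I) (F : I -> M -> 'rV[R]_n) : open U ->
  (forall i, smooth_field U (F i)) -> smooth_field U (fun q => \sum_(i <- s) F i q).
Proof.
move=> oU sF; elim: s => [|i s IH].
  by under eq_fun do rewrite big_nil; exact: smooth_field0.
under eq_fun do rewrite big_cons.
exact: (smooth_field_add oU (sF i) IH).
Qed.

Definition coord_field p (j : 'I_n) : M -> 'rV[R]_n := extend p (delta_mx 0 j).

Definition component p F (j : 'I_n) (q : M) : R := trans q p q (F q) 0 j.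

Lemma coord_field_sum p F q : mdom p q ->
  F q = \sum_j component p F j q *: coord_field p j q.
Proof.
move=> pq; have qq := mdom_center q.
rewrite -[LHS](transK (F q) qq pq) [X in trans p q q X]row_sum_delta linear_sum.
by apply: eq_bigr => j _; rewrite linearZ.
Qed.

Lemma component_chart p F j q : mdom p q ->
  component p F j q = fhat p F (mchart p q) 0 j.
Proof. by move=> pq; rewrite fhat_chart. Qed.

Lemma component_smooth p U F j : open U -> U `<=` mdom p -> smooth_field U F ->
  smooth_fun U (component p F j).
Proof.
move=> oU sU sF; apply: (@smooth_funP _ _ _ p) => // r Ur; have pr := sU _ Ur.
apply: (smooth_at_ext (f := fun x => fhat p F x 0 j)).
  apply: filterS (near_chart oU pr Ur) => x [px [Ux E]] /=.
  by rewrite (component_chart _ _ px) // E.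
apply: smooth_mxcoord; exact: smooth_field_at sF pr Ur.
Qed.

(** [dirder] differentiates in the chart centred at r, [fhat p] in the chart at p. The chain rule
    through the transition map replaces e by its components at p. *)
Lemma dirder_component p U F j r e : open U -> smooth_field U F ->
  mdom p r -> U r ->
  dirder r e (component p F j) = 'd (fhat p F) (mchart p r) (trans r p r e) 0 j.
Proof.
move=> oU sF pr Ur; rewrite /dirder; have rr := mdom_center r.
pose T := mchart p \o mpar r.
have sT : smooth_at T (mchart r r) by exact: transition_smooth_at.
have TE : T (mchart r r) = mchart p r by rewrite /T /= mchartK.
have sFp : smooth_at (fhat p F) (T (mchart r r)).
  by rewrite TE; exact: smooth_field_at sF pr Ur.
have sFj : smooth_at (fun x => @mxcoord R 1 n 0 j (fhat p F x)) (T (mchart r r)).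
  exact: smooth_mxcoord.
have d1 := smooth_at_differentiable sT.
have d2 := smooth_at_differentiable sFj.
have N : \forall x \near mchart r r,
    ((fun x => @mxcoord R 1 n 0 j (fhat p F x)) \o T) x = (component p F j \o mpar r) x.
  apply: filterS (near_chart (mdom_open p) rr pr) => x /= [rx [px _]].
  by rewrite (component_chart _ _ px).
have E1 := congr1 (fun h : 'rV[R]_n -> R => h e) (near_eq_diff N (differentiable_comp d1 d2)).
have E2 := congr1 (fun h : 'rV[R]_n -> R => h e) (diff_comp d1 d2).
apply: etrans E1 _; apply: etrans E2 _.
have cl : continuous (@mxcoord R 1 n 0 j) by exact: mxcoord_continuous.
have E3 := congr1 (fun h : 'rV[R]_n -> R => h ('d T (mchart r r) e))
  (diff_comp (smooth_at_differentiable sFp) (linear_differentiable (fhat p F (T (mchart r r))) cl)).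
apply: etrans E3 _.
have E4 := congr1 (fun h : 'rV[R]_n -> R => h ('d (fhat p F) (T (mchart r r)) ('d T (mchart r r) e)))
  (diff_lin (fhat p F (T (mchart r r))) cl).
apply: etrans E4 _.
have E5 := congr1 (fun y : 'rV[R]_n => 'd (fhat p F) y (trans r p r e) 0 j) TE.
exact: E5.
Qed.

End ConnectionInChart.

(** * Connections in a chart *)

Section ConnectionFormula.
Variables (R : realType) (n : nat) (M : manifold R n) (A : set (tangent M)).
Variables (nabla : connection M) (nablaP : aniso_connection A nabla).
Implicit Types (p q r : M) (U : set M) (F G : M -> 'rV[R]_n) (f : M -> R) (v w : tangent M).

Lemma nabla0r U G v : open U -> smooth_field U G -> A v -> U v.1 ->
  nabla G (fun=> 0) v = 0.
Proof.
move=> oU sG Av Uv.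
have s0 : smooth_field U (fun=> 0 : 'rV[R]_n) by exact: smooth_field0.
have := ac_additive nablaP oU sG s0 s0 Av Uv.
have -> : (fun _ : M => 0 + 0 : 'rV[R]_n) = fun=> 0 by apply: funext => q; rewrite addr0.
by move=> /eqP; rewrite addrC eq_sym -subr_eq0 addrK => /eqP.
Qed.

Lemma smooth_fun1 U : smooth_fun U (fun=> 1 : R).
Proof. by move=> q k; exact: Ck_cst. Qed.

Lemma nabla0l U G v : open U -> smooth_field U G -> A v -> U v.1 ->
  nabla (fun=> 0) G v = 0.
Proof.
move=> oU sG Av Uv.
have s0 : smooth_field U (fun=> 0 : 'rV[R]_n) by exact: smooth_field0.
have := ac_linear nablaP oU (smooth_fun1 U) s0 s0 sG Av Uv.
have -> : (fun _ : M => 1 *: 0 + 0 : 'rV[R]_n) = fun=> 0.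
  by apply: funext => q; rewrite scaler0 addr0.
by rewrite scale1r => /eqP; rewrite addrC eq_sym -subr_eq0 addrK => /eqP.
Qed.

Lemma nabla_sumr U (I : Type) (s : seq I) (f : I -> M -> R) (F : I -> M -> 'rV[R]_n) G v :
  open U -> smooth_field U G -> (forall i, smooth_fun U (f i)) ->
  (forall i, smooth_field U (F i)) -> A v -> U v.1 ->
  nabla G (fun q => \sum_(i <- s) f i q *: F i q) v =
  \sum_(i <- s) (dirder v.1 (G v.1) (f i) *: F i v.1 + f i v.1 *: nabla G (F i) v).
Proof.
move=> oU sG sf sF Av Uv; elim: s => [|i s IH].
  under eq_fun do rewrite big_nil; rewrite big_nil; exact: nabla0r sG Av Uv.
under eq_fun do rewrite big_cons; rewrite big_cons -IH.
rewrite -(ac_Leibniz nablaP oU (sf i) sG (sF i) Av Uv).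
apply: (ac_additive nablaP oU sG _ _ Av Uv); first exact: smooth_field_scale.
by apply: smooth_field_sum => // j; exact: smooth_field_scale.
Qed.

Lemma nabla_suml U (I : Type) (s : seq I) (f : I -> M -> R) (F : I -> M -> 'rV[R]_n) G v :
  open U -> smooth_field U G -> (forall i, smooth_fun U (f i)) ->
  (forall i, smooth_field U (F i)) -> A v -> U v.1 ->
  nabla (fun q => \sum_(i <- s) f i q *: F i q) G v =
  \sum_(i <- s) f i v.1 *: nabla (F i) G v.
Proof.
move=> oU sG sf sF Av Uv; elim: s => [|i s IH].
  under eq_fun do rewrite big_nil; rewrite big_nil; exact: nabla0l sG Av Uv.
under eq_fun do rewrite big_cons; rewrite big_cons -IH.
apply: (ac_linear nablaP oU (sf i) (sF i) _ sG Av Uv).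
by apply: smooth_field_sum => // j; exact: smooth_field_scale.
Qed.

(* X read in the coordinates z = (x, y) of TM *)
Definition hat p (X : tangent M -> 'rV[R]_n) z := tcoord p ((tpar p z).1, X (tpar p z)).

(* Christoffel symbols; they depend on the direction, hence on z *)
Definition chr p i j := hat p (nabla (coord_field p i) (coord_field p j)).

Definition Gam p z (a b : 'rV[R]_n) : 'rV[R]_n :=
  \sum_i \sum_j (a 0 i * b 0 j) *: chr p i j z.

Lemma tparK p v : mdom p v.1 -> tpar p (mchart p v.1, tcoord p v) = v.
Proof.
case: v => r u /= pr; rewrite tparE // tcoordE /=; congr (_, _).
by apply: transK => //; exact: mdom_center.
Qed.

Lemma tcoord_tpar p r y : mdom p r -> tcoord p (tpar p (mchart p r, y)) = y.
Proof.
by move=> pr; rewrite tparE // tcoordE /= transK //; exact: mdom_center.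
Qed.

(** By locality both fields may be replaced by their expansions in coordinate fields. The Leibniz
    rule on the coefficients of F gives the differential, linearity in G and the remaining terms
    give the Christoffel part. *)
Lemma nabla_chart p U G F v : open U -> smooth_field U G -> smooth_field U F ->
  A v -> U v.1 -> mdom p v.1 ->
  trans v.1 p v.1 (nabla G F v) =
  'd (fhat p F) (mchart p v.1) (trans v.1 p v.1 (G v.1))
  + Gam p (mchart p v.1, tcoord p v) (trans v.1 p v.1 (G v.1)) (trans v.1 p v.1 (F v.1)).
Proof.
move=> oU0 sG0 sF0 Av Uv0 pv; have vv := mdom_center v.1.
(* The coordinate fields of the chart at p are smooth only on [mdom p]. *)
pose U' := U `&` mdom p; have oU' : open U' by apply: openI => //; exact: mdom_open.
have Uv : U' v.1 by [].
have sU : U' `<=` mdom p by move=> q [].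
have sG : smooth_field U' G by apply: smooth_field_sub sG0 => q [].
have sF : smooth_field U' F by apply: smooth_field_sub sF0 => q [].
have sD j : smooth_field U' (coord_field p j).
  by apply: smooth_field_sub (extend_smooth p _).
have sC H j : smooth_field U' H -> smooth_fun U' (component p H j) by exact: component_smooth.
have dE H (sH : smooth_field U' H) q : U' q ->
    H q = \sum_j component p H j q *: coord_field p j q.
  by move=> Uq; apply: coord_field_sum; exact: sU.
have sS H : smooth_field U' H -> smooth_field U' (fun q => \sum_j component p H j q *: coord_field p j q).
  by move=> sH; apply: smooth_field_sum => // j; apply: smooth_field_scale => //; exact: sC.
have -> : nabla G F v = \sum_j (dirder v.1 (G v.1) (component p F j) *: coord_field p j v.1
    + component p F j v.1 *:
      \sum_i component p G i v.1 *: nabla (coord_field p i) (coord_field p j) v).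
  rewrite (ac_local nablaP oU' sG sF (E' := G) (H' := fun q => \sum_j component p F j q *: coord_field p j q)) //.
    rewrite (nabla_sumr _ oU' sG) => // [|j]; last exact: sC.
    apply: eq_bigr => j _; congr (_ + _ *: _).
    rewrite (ac_local nablaP oU' sG (sD j) (E' := fun q => \sum_i component p G i q *: coord_field p i q)
       (H' := coord_field p j)) //.
      by rewrite (nabla_suml _ oU' (sD j)) // => i; exact: sC.
    by move=> q Uq; split => //; exact: dE.
  by move=> q Uq; split => //; exact: dE.
rewrite linear_sum /=.
under eq_bigr do rewrite linearD !linearZ /=.
rewrite big_split /=; congr (_ + _).
  rewrite [RHS]row_sum_delta; apply: eq_bigr => j _; congr (_ *: _).
    exact: dirder_component oU' sF pv Uv.
  by rewrite /coord_field /extend transK.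
rewrite /Gam exchange_big /=; apply: eq_bigr => j _.
rewrite linear_sum scaler_sumr; apply: eq_bigr => i _.
rewrite linearZ /= scalerA mulrC /chr /hat tparK //.
Qed.

End ConnectionFormula.

(** * Covariant derivatives of anisotropic fields in coordinates *)

Section NabFieldChart.
Variables (R : realType) (n : nat) (M : manifold R n) (A : set (tangent M)).
Variables (nabla : connection M) (nablaP : aniso_connection A nabla).
Implicit Types (p q r : M) (U : set M) (F G : M -> 'rV[R]_n) (f : M -> R) (v w : tangent M).
Implicit Types (X Y : tangent M -> 'rV[R]_n).

(** The connection axioms ask for fields smooth on an open set of M, whereas composing an
    anisotropic field with an extension of v gives smoothness only as a germ. *)
Lemma smooth_field_near p F r : mdom p r -> smooth_at (fhat p F) (mchart p r) ->
  exists U, [/\ open U, U r, U `<=` mdom p & smooth_field U F].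
Proof.
move=> pr /smooth_at_near N.
have [W [oW Wr] sW] : exists2 W, open_nbhs (mchart p r) W & W `<=` smooth_at (fhat p F).
  by have : nbhs (mchart p r) (smooth_at (fhat p F)) := N; rewrite nbhsE.
pose U := mdom p `&` mchart p @^-1` W.
have oU : open U.
  rewrite openE => q [pq Wq]; apply: filterI; first exact: near_open (mdom_open p) pq.
  exact: (mchart_continuous pq) (near_open oW Wq).
exists U; split => //; first by move=> q [].
apply: (@smooth_fieldP _ _ _ p) => // [q []//|q [pq Wq]]; exact: sW.
Qed.

Definition zcoord p v := (mchart p v.1, tcoord p v).

(* nab_field differentiates x |-> f (x, V x) for an extension V of z.2, and then
   removes the fibre derivative along nabla V = dV(a) + Gamma(a, z.2): the terms
   in dV cancel. *)
Definition cov p (z : 'rV[R]_n * 'rV[R]_n) (a : 'rV[R]_n)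
    (f : 'rV[R]_n * 'rV[R]_n -> 'rV[R]_n) : 'rV[R]_n :=
  'd f z (a, - Gam nabla p z a z.2) + Gam nabla p z a (f z).

Lemma hat_zcoord p X v : mdom p v.1 -> hat p X (zcoord p v) = trans v.1 p v.1 (X v).
Proof. by move=> pv; rewrite /hat tparK. Qed.

Lemma trans_continuous p q r : mdom p r -> mdom q r -> continuous (trans p q r).
Proof.
move=> pr qr; have := diff_continuous (smooth_at_differentiable (transition_smooth_at pr qr)).
exact.
Qed.

(** Since [trans] is linear on each tangent space, a line in the fibre becomes a line in the
    coordinates z with direction (0, u'). *)
Lemma fiber_der_chart p X v u : mdom p v.1 -> smooth_at (hat p X) (zcoord p v) ->
  trans v.1 p v.1 (fiber_der X v u) = 'd (hat p X) (zcoord p v) (0, trans v.1 p v.1 u).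
Proof.
move=> pv sX; have vv := mdom_center v.1; set u' := trans _ _ _ u.
have -> : fiber_der X v u = derive1 (fun t : R =>
    (fun z => trans p v.1 v.1 (hat p X z)) (zcoord p v + t *: (0, u'))) 0.
  rewrite /fiber_der; congr (derive1 _ 0); apply: funext => t.
  have -> : zcoord p v + t *: (0, u') = zcoord p (v.1, v.2 + t *: u).
    rewrite /zcoord; apply/pair_equal_spec; split; rewrite /= ?scaler0 ?addr0 //.
    by rewrite !tcoordE /= linearD linearZ.
  by rewrite hat_zcoord //= transK.
have dX := smooth_at_differentiable sX.
have cT := trans_continuous pv vv.
have dT : differentiable (fun z => trans p v.1 v.1 (hat p X z)) (zcoord p v).
  by apply: (differentiable_comp dX); exact: linear_differentiable.
have E := derive1_line (0, u') dT.
have E2 := diff_lin_at (l := trans p v.1 v.1) (0, u') cT dX.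
have E3 := congr1 (trans v.1 p v.1) (etrans E E2).
apply: etrans E3 _; exact: transK.
Qed.

Lemma nab_field_chart p v e X : A v -> mdom p v.1 -> smooth_at (hat p X) (zcoord p v) ->
  trans v.1 p v.1 (nab_field nabla v e X) = cov p (zcoord p v) (trans v.1 p v.1 e) (hat p X).
Proof.
move=> Av pv sX; have vv := mdom_center v.1.
rewrite /nab_field; set V := extend v.1 v.2; set a := trans _ _ _ e.
set F := fun q => X (q, V q).
have sV := extend_smooth v.1 v.2.
have sVp : smooth_at (fhat p V) (mchart p v.1).
  exact: smooth_field_at (mdom_open _) sV pv vv.
have VE : fhat p V (mchart p v.1) = tcoord p v.
  by rewrite fhat_chart // /V extend_center.
have sP : smooth_at (fun x => (x, fhat p V x)) (mchart p v.1).
  by apply: smooth_at_pair => //; exact: smooth_at_id.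
have sX' : smooth_at (hat p X) ((fun x => (x, fhat p V x)) (mchart p v.1)) by rewrite VE.
(* The representative of X along V is [hat p X] composed with the section x |-> (x, V x), so the
   chain rule gives its differential. *)
have N : \forall x \near mchart p v.1, hat p X (x, fhat p V x) = fhat p F x.
  apply: filterS (near_chart (mdom_open p) pv pv) => x [px [_ xE]].
  rewrite -{1 2}xE fhat_chart // -[_ (mpar p x) (V _)]/(tcoord p (mpar p x, V (mpar p x))).
  by rewrite -/(zcoord p (mpar p x, V (mpar p x))) hat_zcoord.
have sF : smooth_at (fhat p F) (mchart p v.1).
  apply: smooth_at_ext N _; apply: (smooth_at_comp (g := hat p X)) sP sX'.
  by apply: findim_pair; exact: findim_rV.
have [U [oU Uv sUp sFU]] := smooth_field_near pv sF.
pose U' := U `&` mdom v.1.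
have oU' : open U' by apply: openI => //; exact: mdom_open.
have Uv' : U' v.1 by [].
have sE : smooth_field U' (extend v.1 e) by apply: smooth_field_sub (extend_smooth v.1 e) => q [].
have sVU : smooth_field U' V by apply: smooth_field_sub sV => q [].
have sFU' : smooth_field U' F by apply: smooth_field_sub sFU => q [].
have Ee : trans v.1 p v.1 (extend v.1 e v.1) = a by rewrite extend_center.
have TV : trans v.1 p v.1 (V v.1) = tcoord p v by rewrite /V extend_center.
have nV : trans v.1 p v.1 (nab nabla v e V) =
    'd (fhat p V) (mchart p v.1) a + Gam nabla p (zcoord p v) a (tcoord p v).
  by rewrite /nab (nabla_chart nablaP oU' sE sVU Av Uv' pv) Ee TV.
have nF : trans v.1 p v.1 (nab nabla v e F) =
    'd (hat p X) (zcoord p v) (a, 'd (fhat p V) (mchart p v.1) a)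
    + Gam nabla p (zcoord p v) a (hat p X (zcoord p v)).
  rewrite /nab (nabla_chart nablaP oU' sE sFU' Av Uv' pv) Ee; congr (_ + Gam nabla p (zcoord p v) a _).
    have dP := smooth_at_differentiable sP.
    have dX := smooth_at_differentiable sX'.
    have I : differentiable (fun x : 'rV[R]_n => x) (mchart p v.1).
      exact: smooth_at_differentiable (smooth_at_id _).
    have E1 := near_eq_diff_at a N (differentiable_comp dP dX).
    have E2 := diff_comp_at a dP dX.
    have E3 := diff_pair_at a I (smooth_at_differentiable sVp).
    have E4 := congr1 (fun b => (b, 'd (fhat p V) (mchart p v.1) a)) (diff_id_at (mchart p v.1) a).
    have E5 := congr1 (fun b => 'd (hat p X) (mchart p v.1, fhat p V (mchart p v.1)) b) (etrans E3 E4).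
    have E6 := congr1 (fun y => 'd (hat p X) (mchart p v.1, y) (a, 'd (fhat p V) (mchart p v.1) a)) VE.
    apply: etrans E1 _; apply: etrans E2 _; apply: etrans E5 _; exact: E6.
  rewrite hat_zcoord // /F /V extend_center; congr (trans _ _ _ (X _)).
  by case: (v).
rewrite linearB /= nF fiber_der_chart // nV /cov.
set c := 'd (fhat p V) _ a; set g := Gam _ _ _ _ (tcoord p v).
rewrite addrAC; congr (_ + _).
rewrite -linearB; congr ('d (hat p X) _ _).
apply/pair_equal_spec; split; first by rewrite subr0.
by apply: (etrans (y := c - (c + g))) => //; rewrite opprD addrA subrr add0r.
Qed.

End NabFieldChart.

(** * The vertical projection in a chart *)

Section SmoothMatrix.
Variables (R : realType) (V : normedModType R).

Lemma smooth_mulmx m n k (F : V -> 'M[R]_(m, n)) (G : V -> 'M[R]_(n, k)) x :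
  smooth_at F x -> smooth_at G x -> smooth_at (fun y => F y *m G y) x.
Proof.
move=> sF sG; apply: smooth_mx => i j; under eq_fun do rewrite mxE.
by apply: smooth_at_sum => l; apply: smooth_at_mul; exact: smooth_mxcoord.
Qed.

Lemma smooth_det n (F : V -> 'M[R]_n) x :
  smooth_at F x -> smooth_at (fun y => \det (F y)) x.
Proof.
move=> sF; rewrite /determinant; apply: smooth_at_sum => s.
apply: smooth_at_mul; first exact: smooth_at_cst.
by apply: smooth_at_prod => i; exact: smooth_mxcoord.
Qed.

Lemma smooth_invmx n (F : V -> 'M[R]_n) x : F x \in unitmx ->
  smooth_at F x -> smooth_at (fun y => invmx (F y)) x.
Proof.
move=> Fx sF; have sD := smooth_det sF.
have Dx : \det (F x) != 0 by rewrite -unitfE.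
(* [invmx] is given by the adjugate only at invertible matrices; continuity of the determinant
   provides a neighbourhood of such points. *)
have N : \forall y \near x, (\det (F y))^-1 *: \adj (F y) = invmx (F y).
  have N : \forall y \near x, \det (F y) != 0.
    exact: (smooth_at_continuous sD (near_open (@open_neq R 0) Dx)).
  by apply: filterS N => y /= Dy; rewrite /invmx unitmxE unitfE Dy.
apply: smooth_at_ext N _; apply: smooth_at_scale; first exact: smooth_at_inv.
apply: smooth_mx => i j; under eq_fun do rewrite mxE /cofactor.
apply: smooth_at_mul; first exact: smooth_at_cst.
apply: smooth_det; apply: smooth_mx => k l; under eq_fun do rewrite !mxE.
exact: smooth_mxcoord.
Qed.

Lemma smooth_block_mx m1 m2 n1 n2 (F1 : V -> 'M[R]_(m1, n1)) (F2 : V -> 'M[R]_(m1, n2))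
    (F3 : V -> 'M[R]_(m2, n1)) (F4 : V -> 'M[R]_(m2, n2)) x :
  smooth_at F1 x -> smooth_at F2 x -> smooth_at F3 x -> smooth_at F4 x ->
  smooth_at (fun y => block_mx (F1 y) (F2 y) (F3 y) (F4 y)) x.
Proof.
move=> s1 s2 s3 s4; apply: smooth_mx => i j.
case: (split_ordP i) => i' ->; case: (split_ordP j) => j' ->.
- by under eq_fun do rewrite block_mxEul; exact: smooth_mxcoord.
- by under eq_fun do rewrite block_mxEur; exact: smooth_mxcoord.
- by under eq_fun do rewrite block_mxEdl; exact: smooth_mxcoord.
- by under eq_fun do rewrite block_mxEdr; exact: smooth_mxcoord.
Qed.

Lemma diff_sumZ_at (W : normedModType R) (I : Type) (s : seq I) (c : I -> R) (f : I -> V -> W) x v :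
  (forall i, differentiable (f i) x) ->
  differentiable (fun y => \sum_(i <- s) c i *: f i y) x /\
  'd (fun y => \sum_(i <- s) c i *: f i y) x v = \sum_(i <- s) c i *: 'd (f i) x v.
Proof.
move=> df; elim: s => [|i s [IH1 IH2]].
  under eq_fun do rewrite big_nil; rewrite big_nil; split; first exact: differentiable_cst.
  have E := congr1 (fun h : V -> W => h v) (diff_cst (0 : W) x).
  exact: E.
under eq_fun do rewrite big_cons; rewrite big_cons.
have dZ : differentiable (fun y => c i *: f i y) x by exact: differentiableZ.
split; first exact: differentiableD dZ IH1.
have E := congr1 (fun h : V -> W => h v) (diffZ (c i) (df i)).
exact: etrans (diffD_at v dZ IH1) (f_equal2 +%R E IH2).
Qed.

Lemma linear_snd n m (W : lmodType R) (l : {linear ('rV[R]_n * 'rV[R]_m)%type -> W}) b :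
  l (0, b) = \sum_j b 0 j *: l (0, delta_mx 0 j).
Proof.
rewrite {1}[b]row_sum_delta; elim: (index_enum _) => [|j s IH].
  by rewrite !big_nil; exact: linear0.
rewrite !big_cons -IH -linearP; congr (l _).
by apply/pair_equal_spec; split => //=; rewrite scaler0 addr0.
Qed.

Lemma unitmx_inj n (K : 'M[R]_n) : (forall x : 'rV[R]_n, x *m K = 0 -> x = 0) -> K \in unitmx.
Proof.
move=> H; rewrite -row_free_unit -kermx_eq0; apply/eqP/row_matrixP => i.
rewrite row0; apply: H; apply/sub_kermxP; exact: row_sub.
Qed.

End SmoothMatrix.

(** * The fundamental tensor in coordinates *)

Section FundamentalChart.
Variables (R : realType) (n : nat) (M : manifold R n) (A : set (tangent M)).
Variables (L : tangent M -> R) (LP : pseudo_Finsler A L).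
Implicit Types (p q r : M) (v w : tangent M).

(** The Gram matrix of g_v in the chart at p: half the Hessian of L in the fibre coordinates y. *)
Definition fund_mx p (z : 'rV[R]_n * 'rV[R]_n) : 'M[R]_n :=
  \matrix_(i, j) (2^-1 * 'd (fun z' => 'd (L \o tpar p) z' (0, delta_mx 0 j)) z (0, delta_mx 0 i)).

Lemma local_tset_zcoord p v : A v -> mdom p v.1 -> local_tset p A (zcoord p v).
Proof. by move=> Av pv; split; [exists v.1|rewrite tparK]. Qed.

Lemma smooth_at_L p z : local_tset p A z -> smooth_at (L \o tpar p) z.
Proof.
by move=> Az; apply: smooth_on_at (pF_smooth LP p) => //; exact: pF_open LP p.
Qed.

Lemma fund_mx_smooth p z : local_tset p A z -> smooth_at (fund_mx p) z.
Proof.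
move=> Az; apply: smooth_mx => i j; under eq_fun do rewrite mxE.
apply: smooth_at_mul; first exact: smooth_at_cst.
apply: smooth_at_diff; apply: smooth_at_diff; exact: smooth_at_L.
Qed.

Lemma zcoordD p v u (t : R) :
  zcoord p (v.1, v.2 + t *: u) = zcoord p v + t *: (0, trans v.1 p v.1 u).
Proof.
rewrite /zcoord; apply/pair_equal_spec; split; rewrite /= ?scaler0 ?addr0 //.
by rewrite !tcoordE /= linearD linearZ.
Qed.

Lemma fundamental_chart p v e h : A v -> mdom p v.1 ->
  fundamental L v e h =
  (trans v.1 p v.1 e *m fund_mx p (zcoord p v) *m (trans v.1 p v.1 h)^T) 0 0.
Proof.
move=> Av pv; set a := trans _ _ _ e; set b := trans _ _ _ h; set z := zcoord p v.
have Az : local_tset p A z by exact: local_tset_zcoord.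
pose f := L \o tpar p.
have E1 : (fun s : R => derive1 (fun t : R => L (v.1, v.2 + s *: e + t *: h)) 0) =
   (fun s : R => derive1 (fun t : R => f (z + s *: (0, a) + t *: (0, b))) 0).
  apply: funext => s; congr (derive1 _ 0); apply: funext => t.
  rewrite /f /= /z -zcoordD -(zcoordD p (v.1, v.2 + s *: e)) tparK //.
(* The inner derivative is a differential of L only while the moved vector stays admissible.
   Openness of A grants this for small s, which suffices for the outer derivative at 0. *)
have E2 : \forall s \near (0 : R), derive1 (fun t : R => f (z + s *: (0, a) + t *: (0, b))) 0 =
    (fun z' => 'd f z' (0, b)) (z + s *: (0, a)).
  have c : {for (0 : R), continuous (fun s : R => z + s *: (0, a))}.
    apply: continuousD; first exact: cst_continuous.
    by apply: continuousZr_tmp; exact: cvg_id.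
  have N : nbhs (z + 0 *: (0, a)) (local_tset p A).
    by rewrite scale0r addr0; apply: near_open Az; exact: pF_open LP p.
  have N' : \forall s \near (0 : R), local_tset p A (z + s *: (0, a)) by exact: c _ N.
  apply: filterS N' => s As.
  by apply: derive1_line; apply: smooth_at_differentiable; exact: smooth_at_L.
have E3 : fundamental L v e h = 2^-1 * 'd (fun z' => 'd f z' (0, b)) z (0, a).
  rewrite /fundamental E1; congr (_ * _).
  rewrite derive1E (near_eq_derive _ E2) -derive1E.
  apply: derive1_line; apply: smooth_at_differentiable.
  by apply: smooth_at_diff; exact: smooth_at_L.
have E4 : (fun z' => 'd f z' (0, b)) =
    (fun z' => \sum_j b 0 j *: 'd f z' (0, delta_mx 0 j)).
  by apply: funext => z'; exact: linear_snd.
have [_ E5] := diff_sumZ_at (index_enum 'I_n) (fun j => b 0 j) (0, a)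
  (fun j => smooth_at_differentiable (smooth_at_diff (0, delta_mx 0 j) (smooth_at_L Az))).
have E6 := congr1 (fun g : 'rV[R]_n * 'rV[R]_n -> R => 2^-1 * 'd g z (0, a)) E4.
apply: etrans E3 _; apply: etrans E6 _; apply: etrans (congr1 ( *%R 2^-1) E5) _.
rewrite mxE mulr_sumr; apply: eq_bigr => j _.
have E7 := linear_snd ('d (fun y => 'd f y (0, delta_mx 0 j)) z) a.
rewrite [X in _ *: X]E7 !mxE scaler_sumr mulr_sumr mulr_suml; apply: eq_bigr => i _.
have E8 (c x y d : R) : c * (x * (y * d)) = y * (c * d) * x.
  by rewrite [RHS]mulrC mulrCA; congr (_ * _); rewrite mulrCA.
rewrite mxE; exact: E8.
Qed.

End FundamentalChart.

(** * The vertical projection as the solution of a linear system *)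

Section VerticalChart.
Variables (R : realType) (n m : nat) (M : manifold R n) (N : manifold R m).
Variables (A : set (tangent M)) (L : tangent M -> R) (LP : pseudo_Finsler A L).
Variables (sigma : M -> N) (sigmaP : smooth_map sigma).
Hypothesis dsigma_surj : forall p u', exists u, dmap sigma p u = u'.
Hypothesis vertP : forall v, A v -> nondegenerate_on (vertical sigma v.1) (fundamental L v).
Implicit Types (p q r : M) (v w : tangent M).

Definition dsigma_mx p (x : 'rV[R]_n) : 'M[R]_(n, m) :=
  \matrix_(i, j) 'd (mchart (sigma p) \o sigma \o mpar p) x (delta_mx 0 i) 0 j.

(** Here sigma is read by a single coordinate map, with values in the chart at [sigma p], so that
    the vertical spaces become kernels of one matrix-valued function. *)
Definition adapted p : set M := mdom p `&` sigma @^-1` mdom (sigma p).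

Lemma adapted_open p : open (adapted p).
Proof.
have [cs _] := sigmaP.
apply: openI; first exact: mdom_open.
by apply: open_comp; [move=> q _; exact: cs|exact: mdom_open].
Qed.

Lemma adapted_center p : adapted p p.
Proof. by split; exact: mdom_center. Qed.

Lemma sigma_smooth_at (p : N) q r : mdom q r -> mdom p (sigma r) ->
  smooth_at (mchart p \o sigma \o mpar q) (mchart q r).
Proof.
move=> qr pr; have [cs ss] := sigmaP.
apply: smooth_on_at (ss q p); last exact: local_set_chart.
apply: local_set_open; apply: open_comp; [by move=> s _; exact: cs|exact: mdom_open].
Qed.

(** [dmap] at r uses the charts centred at r and [sigma r]. The same local map factors as g o f,
    through these charts, and as h o k, through those of p; the chain rule is applied to both. *)
Lemma dmap_chart p r u : adapted p r ->
  trans (sigma r) (sigma p) (sigma r) (dmap sigma r u) =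
  'd (mchart (sigma p) \o sigma \o mpar p) (mchart p r) (trans r p r u).
Proof.
move=> [pr spr]; have rr := mdom_center r; have srr := mdom_center (sigma r).
pose f := mchart (sigma r) \o sigma \o mpar r.
pose g := mchart (sigma p) \o mpar (sigma r).
pose h := mchart (sigma p) \o sigma \o mpar p.
pose k := mchart p \o mpar r.
have fE : f (mchart r r) = mchart (sigma r) (sigma r) by rewrite /f /= mchartK.
have kE : k (mchart r r) = mchart p r by rewrite /k /= mchartK.
have df := smooth_at_differentiable (sigma_smooth_at rr srr).
have dk := smooth_at_differentiable (transition_smooth_at rr pr).
have dg : differentiable g (f (mchart r r)).
  by rewrite fE; exact: smooth_at_differentiable (transition_smooth_at srr spr).
have dh : differentiable h (k (mchart r r)).
  by rewrite kE; exact: smooth_at_differentiable (sigma_smooth_at pr spr).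
have o : open (sigma @^-1` mdom (sigma r)).
  have [cs _] := sigmaP.
  by apply: open_comp; [move=> q _; exact: cs|exact: mdom_open].
have o' : open (mdom p `&` sigma @^-1` mdom (sigma r)) by apply: openI => //; exact: mdom_open.
have E : \forall x \near mchart r r, g (f x) = h (k x).
  apply: filterS (near_chart o' rr (conj pr srr)) => x [rx [[px sx] _]].
  by rewrite /g /f /h /k /= mchartK // mchartK.
have E1 := diff_comp_at u df dg.
have E2 := diff_comp_at u dk dh.
have E3 := near_eq_diff_at u E (differentiable_comp df dg).
have E4 := congr1 (fun y : 'rV[R]_m => 'd g y (dmap sigma r u)) fE.
have E5 := congr1 (fun y : 'rV[R]_n => 'd h y (trans r p r u)) kE.
exact: etrans (etrans (etrans (esym E4) (esym E1)) (esym E3)) (etrans E2 E5).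
Qed.

Lemma dsigma_mxE p x a :
  'd (mchart (sigma p) \o sigma \o mpar p) x a = a *m dsigma_mx p x.
Proof.
have -> : dsigma_mx p x = lin1_mx ('d (mchart (sigma p) \o sigma \o mpar p) x).
  by apply/matrixP => i j; rewrite !mxE.
by rewrite mul_rV_lin1.
Qed.

Lemma vertical_chart p r u : adapted p r ->
  vertical sigma r u <-> trans r p r u *m dsigma_mx p (mchart p r) = 0.
Proof.
move=> pr; rewrite -dsigma_mxE -dmap_chart //.
have srr := mdom_center (sigma r); have [_ spr] := pr.
split=> [->|E]; first by rewrite linear0.
by rewrite /vertical /= -(transK (dmap sigma r u) srr spr) E linear0.
Qed.

Lemma dsigma_mx_full p r (c : 'rV[R]_m) : adapted p r ->
  exists a, a *m dsigma_mx p (mchart p r) = c.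
Proof.
move=> pr; have srr := mdom_center (sigma r); have [_ spr] := pr.
have [u uE] := dsigma_surj r (trans (sigma p) (sigma r) (sigma r) c).
by exists (trans r p r u); rewrite -dsigma_mxE -dmap_chart // uE transK.
Qed.

(* Orthogonality of a - b to ker S means (a - b) G = l S^T for some l, so that
   (b, l) solves a linear system with matrix block_mx G S S^T 0. *)
Definition saddle_mx p (z : 'rV[R]_n * 'rV[R]_n) : 'M[R]_(n + m) :=
  block_mx (fund_mx L p z) (dsigma_mx p z.1) (dsigma_mx p z.1)^T 0.

(** With K the saddle matrix, [a *m vproj p z] is the component b of the solution of (b, l) K = (a
    G, 0), that is, of b G + l S^T = a G and b S = 0. This form is visibly smooth in z, unlike the
    choice in [vpart]. *)
Definition vproj p z : 'M[R]_n :=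
  lsubmx (row_mx (fund_mx L p z) 0 *m invmx (saddle_mx p z)).

(** If (b, l) K = 0, then b is vertical and orthogonal to all vertical vectors, so b = 0 by
    non-degeneracy; now l S^T = 0, and l = 0 because S is onto. The solved b has the property
    defining [vpart], and non-degeneracy leaves only one such vector. *)
Lemma vproj_vpart p v e : A v -> adapted p v.1 ->
  saddle_mx p (zcoord p v) \in unitmx /\
  trans v.1 p v.1 (vpart L sigma v e) = trans v.1 p v.1 e *m vproj p (zcoord p v).
Proof.
move=> Av ap; have [pv spv] := ap; have vv := mdom_center v.1.
set G := fund_mx L p (zcoord p v); set S := dsigma_mx p (mchart p v.1).
set T := trans v.1 p v.1; pose T' := trans p v.1 v.1.
have TK u : T' (T u) = u by exact: transK.
have T'K u : T (T' u) = u by exact: transK.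
have TB x y : T (x - y) = T x - T y by exact: linearB.
have T'B x y : T' (x - y) = T' x - T' y by exact: linearB.
have gE e1 e2 : fundamental L v e1 e2 = (T e1 *m G *m (T e2)^T) 0 0 by have := fundamental_chart LP e1 e2 Av pv.
have vE u : vertical sigma v.1 u <-> T u *m S = 0 by exact: vertical_chart.
(* A covector of the form l S^T annihilates ker S; hence l acts as a Lagrange multiplier for the
   vertical constraint. *)
have orth (c : 'rV[R]_n) (l : 'rV[R]_m) u : c *m G = l *m S^T -> vertical sigma v.1 u ->
    fundamental L v (T' c) u = 0.
  move=> cE /vE uS; rewrite gE T'K cE -mulmxA -trmx_mul uS trmx0 mulmx0 mxE //.
have KE b l : row_mx b l *m saddle_mx p (zcoord p v) = row_mx (b *m G + l *m S^T) (b *m S).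
  by rewrite /saddle_mx mul_row_block mulmx0 addr0.
have KU : saddle_mx p (zcoord p v) \in unitmx.
  apply: unitmx_inj => x; rewrite -[x]hsubmxK; set b := lsubmx x; set l := rsubmx x.
  rewrite KE -[0]row_mx0 => /eq_row_mx [E1 E2].
  have b0 : b = 0.
    suff Tb0 : T' b = 0 by rewrite -(T'K b) Tb0; exact: linear0.
    apply: (vertP Av) => [|u uV]; first by apply/vE; rewrite T'K.
    apply: (orth b (- l)) uV.
    by rewrite mulNmx; apply/eqP; rewrite -addr_eq0 E1.
  have l0 : l = 0.
    (* A preimage a of the k-th basis vector under S extracts the k-th entry of l from l S^T = 0. *)
    apply/rowP => k; have [a aE] := dsigma_mx_full (delta_mx 0 k) ap.
    have : l *m S^T *m a^T = 0 by rewrite b0 mul0mx add0r in E1; rewrite E1 mul0mx.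
    rewrite -mulmxA -trmx_mul aE => /matrixP /(_ 0 0).
    by rewrite trmx_delta -colE !mxE.
  by rewrite b0 l0.
split; first exact: KU.
set b := _ *m vproj p _.
pose l := rsubmx (row_mx (T e *m G) 0 *m invmx (saddle_mx p (zcoord p v))).
have bl : row_mx b l = row_mx (T e *m G) 0 *m invmx (saddle_mx p (zcoord p v)).
  rewrite -[RHS]hsubmxK; congr (row_mx _ _); rewrite /b /vproj -/G -/T.
  by rewrite mulmx_lsub mulmxA mul_mx_row mulmx0.
have : row_mx b l *m saddle_mx p (zcoord p v) = row_mx (T e *m G) 0 by rewrite bl mulmxKV.
rewrite KE => /eq_row_mx [E1 E2].
pose Q (w : 'rV[R]_n) := vertical sigma v.1 w /\
  forall u, vertical sigma v.1 u -> fundamental L v (e - w) u = 0.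
have Qb : Q (T' b).
  split=> [|u uV]; first by apply/vE; rewrite T'K.
  have -> : e - T' b = T' (T e - b) by rewrite T'B TK.
  apply: (orth _ l) uV; rewrite mulmxBl -E1 addrAC subrr add0r //.
(* The witness [T' b] keeps [xget] away from its default 0. *)
have QV : Q (vpart L sigma v e) by exact: (@xgetPex _ 0 Q (ex_intro _ _ Qb)).
rewrite -(T'K b); congr (T _); apply/eqP; rewrite -subr_eq0; apply/eqP.
have [V1 O1] := QV; have [V2 O2] := Qb.
apply: (vertP Av) => [|u uV].
  by apply/vE; rewrite TB mulmxBl; move/vE: V1 => ->; move/vE: V2 => ->; rewrite subrr.
have gB x y : fundamental L v (x - y) u = fundamental L v x u - fundamental L v y u.
  by rewrite !gE TB !mulmxBl !mxE.
have -> : vpart L sigma v e - T' b = (e - T' b) - (e - vpart L sigma v e).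
  by rewrite opprB [RHS]addrC addrA subrK.
by rewrite gB O1 // O2 // subrr.
Qed.

Lemma vproj_ker p z (a : 'rV[R]_n) : saddle_mx p z \in unitmx -> a *m vproj p z *m dsigma_mx p z.1 = 0.
Proof.
move=> KU; pose l := rsubmx (row_mx (fund_mx L p z) 0 *m invmx (saddle_mx p z)).
have : row_mx (vproj p z) l *m saddle_mx p z = row_mx (fund_mx L p z) 0.
  by rewrite hsubmxK mulmxKV.
rewrite mul_row_block mulmx0 addr0 => /eq_row_mx [_ E].
by rewrite -mulmxA E mulmx0.
Qed.

(** For c in the kernel of S, the pair (c, 0) already solves the system with right-hand side (c G,
    0). *)
Lemma vproj_id p z (c : 'rV[R]_n) : saddle_mx p z \in unitmx -> c *m dsigma_mx p z.1 = 0 ->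
  c *m vproj p z = c.
Proof.
move=> KU E; rewrite mulmx_lsub mulmxA mul_mx_row mulmx0.
have -> : row_mx (c *m fund_mx L p z) 0 = row_mx c 0 *m saddle_mx p z.
  by rewrite mul_row_block !mul0mx !addr0 E.
by rewrite mulmxK // row_mxKl.
Qed.

Lemma vproj_idem p z : saddle_mx p z \in unitmx -> vproj p z *m vproj p z = vproj p z.
Proof.
move=> KU; apply/row_matrixP => i; rewrite row_mul.
by apply: vproj_id => //; rewrite rowE vproj_ker.
Qed.

Definition region p (z : 'rV[R]_n * 'rV[R]_n) := local_tset p A z /\ adapted p (mpar p z.1).

(** Every z in the region comes from an actual admissible vector, so statements about vectors become
    identities of functions of z, which can be differentiated. *)
Lemma regionP p z : region p z -> exists v,
  [/\ A v, adapted p v.1, z = zcoord p v & v = tpar p z].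
Proof.
case: z => x y [[[r pr xE] Az] ap]; move: Az ap; rewrite /= in xE *.
rewrite -xE /= mchartK // => Az ap; exists (tpar p (mchart p r, y)).
have vr : (tpar p (mchart p r, y)).1 = r by rewrite tparE.
by split; rewrite ?vr // /zcoord vr tcoord_tpar.
Qed.

Lemma region_zcoord p v : A v -> adapted p v.1 -> region p (zcoord p v).
Proof.
move=> Av [pv spv]; split; first exact: local_tset_zcoord.
by rewrite /= mchartK.
Qed.

Lemma saddle_mx_unit p z : region p z -> saddle_mx p z \in unitmx.
Proof. by move=> /regionP [v [Av ap -> _]]; have [] := vproj_vpart 0 Av ap. Qed.

Lemma vproj_smooth p z : region p z -> smooth_at (vproj p) z.
Proof.
move=> rz; have KU := saddle_mx_unit rz.
have [Az ap] := rz.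
have sG : smooth_at (fund_mx L p) z by exact: (fund_mx_smooth LP Az).
have sS : smooth_at (fun z' : 'rV[R]_n * 'rV[R]_n => dsigma_mx p z'.1) z.
  apply: (smooth_at_comp (f := fst) (g := dsigma_mx p)); first exact: findim_rV.
    apply: (smooth_at_linear (l := fst : {linear ('rV[R]_n * 'rV[R]_n)%type -> 'rV[R]_n})).
    by move=> x; exact: cvg_fst.
  apply: smooth_mx => i j; under eq_fun do rewrite mxE.
  apply: smooth_mxcoord; apply: smooth_at_diff.
  case: Az => [[r pr <-] _] /= in ap *; move: ap; rewrite mchartK // => -[_ spr].
  exact: sigma_smooth_at.
have sK : smooth_at (saddle_mx p) z.
  apply: smooth_block_mx => //; last exact: smooth_at_cst.
  apply: smooth_mx => i j; under eq_fun do rewrite mxE; exact: smooth_mxcoord.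
have sI := smooth_invmx KU sK.
apply: smooth_mx => i j; under eq_fun do rewrite /vproj mxE.
apply: smooth_mxcoord; apply: smooth_mulmx => //.
apply: smooth_mx => k l; case: (split_ordP l) => l' ->.
  by under eq_fun do rewrite row_mxEl; exact: smooth_mxcoord.
by under eq_fun do rewrite row_mxEr; exact: smooth_at_cst.
Qed.

End VerticalChart.

(** * Splitting the covariant derivative *)

Section Covariant.
Variables (R : realType) (n : nat) (M : manifold R n) (A : set (tangent M)).
Variables (nabla : connection M) (nablaP : aniso_connection A nabla) (openA : tangent_open A).
Variable p : M.
Local Notation TV := ('rV[R]_n * 'rV[R]_n)%type.
Implicit Types (z : TV) (f g : TV -> 'rV[R]_n) (a b : 'rV[R]_n).

Local Notation Gam := (Gam nabla p).
Local Notation cov := (cov nabla p).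

Lemma GamDl z a a' b : Gam z (a + a') b = Gam z a b + Gam z a' b.
Proof.
rewrite /Gam -big_split; apply: eq_bigr => i _; rewrite -big_split; apply: eq_bigr => j _.
by rewrite mxE mulrDl scalerDl.
Qed.

Lemma GamDr z a b b' : Gam z a (b + b') = Gam z a b + Gam z a b'.
Proof.
rewrite /Gam -big_split; apply: eq_bigr => i _; rewrite -big_split; apply: eq_bigr => j _.
by rewrite mxE mulrDr scalerDl.
Qed.

Lemma Gam0r z a : Gam z a 0 = 0.
Proof. by rewrite /Gam big1 // => i _; rewrite big1 // => j _; rewrite mxE mulr0 scale0r. Qed.

Lemma chr_smooth i j z : local_tset p A z -> smooth_at (chr nabla p i j) z.
Proof.
move=> Az; have oD := mdom_open p.
have sD k : smooth_field (mdom p) (coord_field p k) by exact: extend_smooth.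
have E : local_tset p (A `&` [set v | mdom p v.1]) = local_tset p A.
  apply/seteqP; split=> z' [zp] /=; first by move=> [Az' _].
  by move=> Az'; split => //; split => //=; case: zp => r pr <-; rewrite mchartK.
have := ac_smooth nablaP oD (sD i) (sD j) p; rewrite E => s.
by apply: smooth_on_at s => //; exact: openA.
Qed.

Lemma Gam_smooth (a b : TV -> 'rV[R]_n) z : local_tset p A z -> smooth_at a z -> smooth_at b z ->
  smooth_at (fun z => Gam z (a z) (b z)) z.
Proof.
move=> Az sa sb; apply: smooth_at_sum => i; apply: smooth_at_sum => j.
apply: smooth_at_scale; last exact: chr_smooth.
by apply: smooth_at_mul; exact: smooth_mxcoord.
Qed.

Lemma cov_smooth (a f : TV -> 'rV[R]_n) z : local_tset p A z -> smooth_at a z ->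
  smooth_at f z -> smooth_at (fun z => cov z (a z) f) z.
Proof.
move=> Az sa sf; apply: smooth_at_add; last exact: Gam_smooth.
apply: smooth_at_diff_var => //; first by apply: findim_pair; exact: findim_rV.
apply: smooth_at_pair => //; apply: smooth_at_opp; apply: Gam_smooth => //.
apply: (smooth_at_linear (l := snd : {linear TV -> 'rV[R]_n})).
by move=> x; exact: cvg_snd.
Qed.

Lemma covDf z a f g : smooth_at f z -> smooth_at g z ->
  cov z a (fun z => f z + g z) = cov z a f + cov z a g.
Proof.
move=> sf sg; have E := diffD_at (a, - Gam z a z.2)
  (smooth_at_differentiable sf) (smooth_at_differentiable sg).
apply: etrans (f_equal2 +%R E (GamDr z a (f z) (g z))) _; exact: addrACA.
Qed.

Lemma covDa z a a' f : cov z (a + a') f = cov z a f + cov z a' f.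
Proof.
have E : (a + a', - Gam z (a + a') z.2) = (a, - Gam z a z.2) + (a', - Gam z a' z.2).
  by apply/pair_equal_spec; split => //=; rewrite GamDl opprD.
have E1 := etrans (congr1 (fun w => 'd f z w) E) (linearD ('d f z) _ _).
apply: etrans (f_equal2 +%R E1 (GamDl z a a' (f z))) _; exact: addrACA.
Qed.

Lemma cov_near z a f g : (\forall z' \near z, f z' = g z') -> smooth_at f z ->
  cov z a f = cov z a g.
Proof.
move=> N sf.
have E := near_eq_diff_at (a, - Gam z a z.2) N (smooth_at_differentiable sf).
exact: (f_equal2 +%R (esym E) (congr1 (Gam z a) (nbhs_singleton N))).
Qed.

Lemma covNf z a f : smooth_at f z -> cov z a (fun z => - f z) = - cov z a f.
Proof.
move=> sf; have E1 := covDf a sf (smooth_at_opp sf).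
have E2 : (fun z => f z + - f z) = fun=> 0 by apply: funext => z'; exact: subrr.
have E3 := congr1 (fun h : TV -> 'rV[R]_n => h (a, - Gam z a z.2)) (diff_cst (0 : 'rV[R]_n) z).
have E4 : cov z a (fun=> 0) = 0 := etrans (f_equal2 +%R E3 (Gam0r z a)) (addr0 _).
apply/esym/addr0_eq; exact: etrans (esym E1) (etrans (congr1 (cov z a) E2) E4).
Qed.

Lemma covBf z a f g : smooth_at f z -> smooth_at g z ->
  cov z a (fun z => f z - g z) = cov z a f - cov z a g.
Proof.
move=> sf sg; apply: etrans (covDf a sf (smooth_at_opp sg)) _.
have E := congr1 (fun b => cov z a f + b) (covNf a sg).
exact: E.
Qed.

(** Where f vanishes, the product rule loses its term in dF and both Christoffel terms are zero. *)
Lemma cov_mulmx z a f (F : TV -> 'M[R]_n) : smooth_at f z -> smooth_at F z -> f z = 0 ->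
  cov z a (fun z => f z *m F z) = cov z a f *m F z.
Proof.
move=> sf sF f0; set w := (a, - Gam z a z.2).
have G0 : Gam z a (f z) = 0 by rewrite f0 Gam0r.
have G1 : Gam z a (f z *m F z) = 0 by rewrite f0 mul0mx Gam0r.
suff E : 'd (fun z => f z *m F z) z w = 'd f z w *m F z.
  apply: etrans (f_equal2 +%R E G1) _; rewrite addr0.
  by apply: esym; apply: etrans (congr1 (fun b => ('d f z w + b) *m F z) G0) _; rewrite addr0.
(* The factors 1 give the sum the shape expected by [diff_sumZ_at]. *)
have E : (fun z => f z *m F z) = fun z => \sum_(k <- index_enum 'I_n) 1 *: (f z 0 k *: row k (F z)).
  apply: funext => z'; rewrite mulmx_sum_row; apply: eq_bigr => k _; rewrite scale1r //.
have dfk k : smooth_at (fun z => f z 0 k) z by exact: smooth_mxcoord.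
have dFk k : smooth_at (fun z => row k (F z)) z.
  by apply: smooth_mx => i j; under eq_fun do rewrite mxE; exact: smooth_mxcoord.
have D k : is_diff z (fun z => f z 0 k *: row k (F z))
    (fun v => f z 0 k *: 'd (fun z => row k (F z)) z v + 'd (fun z => f z 0 k) z v *: row k (F z)).
  by apply: is_diff_scale; exact: smooth_at_differentiable.
have [_ E1] := diff_sumZ_at (index_enum 'I_n) (fun=> 1) w (fun k => @ex_diff _ _ _ _ _ _ _ (D k)).
have E0 := congr1 (fun h : TV -> 'rV[R]_n => 'd h z w) E.
apply: etrans E0 _; apply: etrans E1 _.
rewrite mulmx_sum_row; apply: eq_bigr => k _; rewrite scale1r.
have E2 := congr1 (fun h : TV -> 'rV[R]_n => h w) (@diff_val _ _ _ _ _ _ _ (D k)).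
apply: etrans E2 _; rewrite f0 mxE scale0r add0r; congr (_ *: _).
exact: (diff_lin_at (l := @mxcoord R 1 n 0 k) w (@mxcoord_continuous R 1 n 0 k)
  (smooth_at_differentiable sf)).
Qed.

End Covariant.

(** * The mixed part of the covariant derivative and its tensoriality *)

Section Mixed.
Variables (R : realType) (n : nat) (M : manifold R n) (A : set (tangent M)).
Variables (nabla : connection M) (nablaP : aniso_connection A nabla) (openA : tangent_open A).
Variable p : M.
Local Notation TV := ('rV[R]_n * 'rV[R]_n)%type.
Variable P : TV -> 'M[R]_n.
Local Notation Q := (fun z => 1%:M - P z).
Implicit Types (z : TV) (f g : TV -> 'rV[R]_n) (a b : 'rV[R]_n).

Local Notation cov := (cov nabla p).

(* chi_a f, read in the chart *)
Definition mixed z a f : 'rV[R]_n :=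
  cov z a (fun z => f z *m Q z) *m P z + cov z a (fun z => f z *m P z) *m Q z.

Lemma smooth_compl z : smooth_at P z -> smooth_at Q z.
Proof. by move=> sP; apply: smooth_at_sub => //; exact: smooth_at_cst. Qed.

Lemma mulmx_compl (x : 'rV[R]_n) z : x = x *m P z + x *m Q z.
Proof. by rewrite -mulmxDr addrC subrK mulmx1. Qed.

Lemma mulmx_idem_compl z : P z *m P z = P z -> P z *m Q z = 0.
Proof. by move=> E; rewrite mulmxBr mulmx1 E subrr. Qed.

Lemma mulmx_compl_idem z : P z *m P z = P z -> Q z *m P z = 0.
Proof. by move=> E; rewrite mulmxBl mul1mx E subrr. Qed.

Lemma mulmx_compl_compl z : P z *m P z = P z -> Q z *m Q z = Q z.
Proof. by move=> E; rewrite mulmxBr mulmx1 mulmx_compl_idem // subr0. Qed.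

Lemma mixedDa z a a' f : mixed z (a + a') f = mixed z a f + mixed z a' f.
Proof. by rewrite /mixed !covDa !mulmxDl addrACA. Qed.

Lemma mixedBf z a f g : smooth_at P z -> smooth_at f z -> smooth_at g z ->
  mixed z a (fun z => f z - g z) = mixed z a f - mixed z a g.
Proof.
move=> sP sf sg; have sQ := smooth_compl sP.
have E (F : TV -> 'M[R]_n) : smooth_at F z ->
    cov z a (fun z => (f z - g z) *m F z) = cov z a (fun z => f z *m F z) - cov z a (fun z => g z *m F z).
  move=> sF; have := covBf nabla p a (smooth_mulmx sf sF) (smooth_mulmx sg sF).
  have -> : (fun z => f z *m F z - g z *m F z) = (fun z => (f z - g z) *m F z).
    by apply: funext => z'; rewrite mulmxBl.
  exact.
have -> : mixed z a (fun z => f z - g z) = (cov z a (fun z => f z *m Q z) - cov z a (fun z => g z *m Q z)) *m P z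
    + (cov z a (fun z => f z *m P z) - cov z a (fun z => g z *m P z)) *m Q z.
  have E' := f_equal2 (fun x y : 'rV[R]_n => x *m P z + y *m Q z) (E _ sQ) (E _ sP).
  exact: E'.
by rewrite !mulmxBl /mixed opprD addrACA.
Qed.

(** Applied to f - g, [cov_mulmx] pulls both projections out of the derivative and leaves the
    products QP and PQ, which vanish by idempotence. *)
Lemma mixed_ext z a f g : smooth_at P z -> P z *m P z = P z ->
  smooth_at f z -> smooth_at g z -> f z = g z -> mixed z a f = mixed z a g.
Proof.
move=> sP PP sf sg fg; apply/eqP; rewrite -subr_eq0 -mixedBf //; apply/eqP.
have sQ := smooth_compl sP; have sh := smooth_at_sub sf sg.
have h0 : f z - g z = 0 by rewrite fg subrr.
have E1 := cov_mulmx nabla p a sh sQ h0.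
have E2 := cov_mulmx nabla p a sh sP h0.
have E3 := f_equal2 (fun x y : 'rV[R]_n => x *m P z + y *m Q z) E1 E2.
apply: etrans E3 _ => /=.
by rewrite -!mulmxA mulmx_idem_compl // mulmx_compl_idem // !mulmx0 addr0.
Qed.

Lemma cov_split z a f : smooth_at P z -> smooth_at f z ->
  cov z a f = cov z a (fun z => f z *m P z) *m P z + cov z a (fun z => f z *m Q z) *m Q z
    + mixed z a f.
Proof.
move=> sP sf; have sQ := smooth_compl sP.
have E := covDf nabla p a (smooth_mulmx sf sP) (smooth_mulmx sf sQ).
have E1 : (fun z => f z *m P z + f z *m Q z) = f.
  by apply: funext => z'; rewrite -mulmx_compl.
apply: etrans (congr1 (cov z a) (esym E1)) _; apply: etrans E _.
rewrite /mixed; set x := cov z a _; set y := cov z a _.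
rewrite {1}(mulmx_compl x z) {1}(mulmx_compl y z).
by rewrite [y *m P z + _]addrC addrACA [x *m Q z + _]addrC.
Qed.

Lemma mixed_smooth (a f : TV -> 'rV[R]_n) z : local_tset p A z -> smooth_at P z ->
  smooth_at a z -> smooth_at f z -> smooth_at (fun z => mixed z (a z) f) z.
Proof.
move=> Az sP sa sf; have sQ := smooth_compl sP.
by apply: smooth_at_add; apply: smooth_mulmx => //;
  apply: (cov_smooth nablaP openA) => //; exact: smooth_mulmx.
Qed.

(* cov along h is u + w + k with k the mixed part, and tensoriality evaluates
   mixed a (u + w) from the value u + w = cov - k at z0 alone. *)
Lemma cov2_split z0 (h b : TV -> 'rV[R]_n) a :
  (\forall z \near z0, [/\ local_tset p A z, smooth_at P z, P z *m P z = P z & smooth_at b z]) ->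
  smooth_at h z0 ->
  cov z0 a (fun z => cov z (h z) b) =
  cov z0 a (fun z => cov z (h z) (fun z => b z *m P z) *m P z) *m P z0 +
  cov z0 a (fun z => cov z (h z) (fun z => b z *m Q z) *m Q z) *m Q z0 +
  cov z0 a (fun z => mixed z (h z) b) +
  (mixed z0 a (fun=> cov z0 (h z0) b) - mixed z0 a (fun=> mixed z0 (h z0) b)).
Proof.
move=> N sh; have [Az sP PP sb] := nbhs_singleton N.
have sQ := smooth_compl sP.
pose u z := cov z (h z) (fun z => b z *m P z) *m P z.
pose w z := cov z (h z) (fun z => b z *m Q z) *m Q z.
pose k z := mixed z (h z) b.
have su : smooth_at u z0.
  apply: smooth_mulmx => //; apply: (cov_smooth nablaP openA) => //; exact: smooth_mulmx.
have sw : smooth_at w z0.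
  apply: smooth_mulmx => //; apply: (cov_smooth nablaP openA) => //; exact: smooth_mulmx.
have sk : smooth_at k z0 by exact: mixed_smooth.
have suw := smooth_at_add su sw.
have sc : smooth_at (fun z => cov z (h z) b) z0 by exact: (cov_smooth nablaP openA).
have E1 : \forall z \near z0, cov z (h z) b = (u z + w z) + k z.
  by apply: filterS N => z [_ sPz _ sbz]; exact: cov_split.
(* Since u takes values in the image of P and w in that of Q, splitting cov of u + w returns u and w
   as its two projected fields. *)
have E2 : \forall z \near z0, u z = (u z + w z) *m P z.
  apply: filterS N => z [_ _ PPz _]; rewrite mulmxDl /u /w -!mulmxA PPz mulmx_compl_idem //.
  by rewrite mulmx0 addr0.
have E3 : \forall z \near z0, w z = (u z + w z) *m Q z.
  apply: filterS N => z [_ _ PPz _]; rewrite mulmxDl /u /w -!mulmxA mulmx_idem_compl // mulmx_compl_compl //.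
  by rewrite mulmx0 add0r.
apply: etrans (cov_near nabla p a E1 sc) _.
apply: etrans (covDf nabla p a suw sk) _.
have C1 := esym (cov_near nabla p a E2 su).
have C2 := esym (cov_near nabla p a E3 sw).
(* Constant functions with the right value at z0 are chosen because [ONeillTA_mixed] expresses the
   O'Neill tensors by [mixed] of a constant. *)
have sc1 : smooth_at (fun=> cov z0 (h z0) b) z0 by exact: smooth_at_cst.
have sc2 : smooth_at (fun=> mixed z0 (h z0) b) z0 by exact: smooth_at_cst.
have uwE : u z0 + w z0 = cov z0 (h z0) b - mixed z0 (h z0) b.
  by rewrite (nbhs_singleton E1) addrK.
have C3 := etrans (mixed_ext a sP PP suw (smooth_at_sub sc1 sc2) uwE) (mixedBf a sP sc1 sc2).
have C4 : cov z0 a (fun z => u z + w z) = cov z0 a u *m P z0 + cov z0 a w *m Q z0 +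
    (mixed z0 a (fun=> cov z0 (h z0) b) - mixed z0 a (fun=> mixed z0 (h z0) b)).
  apply: etrans (cov_split a sP suw) _.
  exact: (f_equal2 +%R (f_equal2 (fun x y : 'rV[R]_n => x *m P z0 + y *m Q z0) C1 C2) C3).
have C5 := congr1 (fun x => x + cov z0 a k) C4.
apply: etrans C5 _; exact: addrAC.
Qed.

End Mixed.

(** * The O'Neill tensors in a chart *)

Section SubmersionChart.
Variables (R : realType) (n m : nat) (M : manifold R n) (N : manifold R m).
Variables (A : set (tangent M)) (L : tangent M -> R) (LP : pseudo_Finsler A L).
Variables (sigma : M -> N) (sigmaP : smooth_map sigma).
Hypothesis dsigma_surj : forall p u', exists u, dmap sigma p u = u'.
Hypothesis vertP : forall v, A v -> nondegenerate_on (vertical sigma v.1) (fundamental L v).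
Variables (nabla : connection M) (nablaP : aniso_connection A nabla).
Variable p : M.
Implicit Types (v w : tangent M) (X : tangent M -> 'rV[R]_n) (F G : M -> 'rV[R]_n).
Local Notation TV := ('rV[R]_n * 'rV[R]_n)%type.

Local Notation P := (vproj L sigma p).
Local Notation Q := (fun z => 1%:M - P z).
Local Notation T v := (trans v.1 p v.1).
Local Notation cov := (cov nabla p).

Lemma fst_smooth (z : TV) : smooth_at (fst : TV -> 'rV[R]_n) z.
Proof.
apply: (smooth_at_linear (l := fst : {linear TV -> 'rV[R]_n})).
by move=> x; exact: cvg_fst.
Qed.

Lemma region_near z (U : set M) : region A sigma p z -> open U -> U (mpar p z.1) ->
  \forall z' \near z, region A sigma p z' /\ U (mpar p z'.1).
Proof.
move=> [Az ap] oU Uz; have oa := adapted_open sigmaP p.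
have zE : z.1 = mchart p (mpar p z.1).
  by case: Az => -[r pr <-] _; rewrite mchartK.
have [pz _] := ap.
have NU : \forall x \near z.1, mdom p (mpar p x) /\ (adapted sigma p `&` U) (mpar p x)
    /\ mchart p (mpar p x) = x.
  rewrite zE; apply: near_chart => //; first exact: openI.
have Nz : \forall z' \near z, mdom p (mpar p z'.1) /\ (adapted sigma p `&` U) (mpar p z'.1)
    /\ mchart p (mpar p z'.1) = z'.1.
  exact: (smooth_at_continuous (fst_smooth z) NU).
have oT : open (local_tset p A) by exact: (pF_open LP).
have NA := near_open oT Az.
apply: filterS2 NA Nz => z' Az' [_ [[ap' Uz'] _]].
by split.
Qed.

Lemma vpart_chart v e : A v -> adapted sigma p v.1 ->
  T v (vpart L sigma v e) = T v e *m P (zcoord p v).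
Proof. by move=> Av ap; have [] := vproj_vpart LP sigmaP dsigma_surj vertP e Av ap. Qed.

Lemma hpart_chart v e : A v -> adapted sigma p v.1 ->
  T v (hpart L sigma v e) = T v e *m Q (zcoord p v).
Proof. by move=> Av ap; rewrite linearB /= vpart_chart // mulmxBr mulmx1. Qed.

Lemma hat_vfield X z : region A sigma p z ->
  hat p (vfield L sigma X) z = hat p X z *m P z.
Proof.
move=> /regionP [v [Av ap -> _]]; have [pv _] := ap.
by rewrite !hat_zcoord // vpart_chart.
Qed.

Lemma hat_hfield X z : region A sigma p z ->
  hat p (hfield L sigma X) z = hat p X z *m Q z.
Proof.
move=> /regionP [v [Av ap -> _]]; have [pv _] := ap.
by rewrite !hat_zcoord // hpart_chart.
Qed.

Lemma vproj_at z : region A sigma p z -> smooth_at P z /\ P z *m P z = P z.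
Proof.
move=> rz; have KU := saddle_mx_unit LP sigmaP dsigma_surj vertP rz.
have sP := vproj_smooth LP sigmaP dsigma_surj vertP rz.
have PP := vproj_idem KU.
by split.
Qed.

(** The projected fields have a matrix formula only over the region, so the representative is
    allowed to agree with f merely near the point. *)
Lemma nab_field_cov v e X f : A v -> mdom p v.1 ->
  (\forall z \near zcoord p v, f z = hat p X z) -> smooth_at f (zcoord p v) ->
  T v (nab_field nabla v e X) = cov (zcoord p v) (T v e) f.
Proof.
move=> Av pv E sf; have sX := smooth_at_ext E sf.
by rewrite (nab_field_chart nablaP e Av pv sX); apply/esym; exact: cov_near.
Qed.

Lemma hat_vlift_smooth (U : set M) F v : open U -> smooth_field U F -> mdom p v.1 -> U v.1 ->
  smooth_at (hat p (vlift F)) (zcoord p v).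
Proof.
move=> oU sF pv Uv.
apply: (smooth_at_comp (f := fst) (g := fhat p F)); first exact: findim_rV.
  exact: fst_smooth.
exact: smooth_field_at sF pv Uv.
Qed.

(** The lift of an ordinary field does not depend on y, so the fibre correction inside [cov]
    contributes nothing. *)
Lemma nabla_cov (U : set M) G F v : open U -> smooth_field U G -> smooth_field U F ->
  A v -> U v.1 -> mdom p v.1 ->
  T v (nabla G F v) = cov (zcoord p v) (T v (G v.1)) (hat p (vlift F)).
Proof.
move=> oU sG sF Av Uv pv; rewrite (nabla_chart nablaP oU sG sF Av Uv pv).
set a := T v (G v.1); set w := (a, - Gam nabla p (zcoord p v) a (zcoord p v).2).
have ds := smooth_at_differentiable (fst_smooth (zcoord p v)).
have dF := smooth_at_differentiable (smooth_field_at oU sF pv Uv).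
have E1 := diff_comp_at (f := fst) (g := fhat p F) w ds dF.
have cf : continuous (fst : {linear TV -> 'rV[R]_n}) by move=> x; exact: cvg_fst.
have E2 := congr1 (fun h : TV -> 'rV[R]_n => h w) (diff_lin (zcoord p v) cf).
have E3 := congr1 ('d (fhat p F) (mchart p v.1)) E2.
have E4 : hat p (vlift F) (zcoord p v) = T v (F v.1) by rewrite hat_zcoord.
apply/esym; exact: (f_equal2 +%R (etrans E1 E3) (congr1 (Gam nabla p (zcoord p v) a) E4)).
Qed.

(** Only the value of E at the base point enters the chart formula, so E and [extend v.1 (E v.1)]
    give the same derivative. *)
Lemma nab_nabla (U : set M) E F v : open U -> smooth_field U E -> smooth_field U F ->
  A v -> U v.1 -> mdom p v.1 ->
  nab nabla v (E v.1) F = nabla E F v.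
Proof.
move=> oU sE sF Av Uv pv; have vv := mdom_center v.1.
have oU' : open (U `&` mdom v.1) by apply: openI => //; exact: mdom_open.
have sF' : smooth_field (U `&` mdom v.1) F by apply: smooth_field_sub sF => q [].
have sE' : smooth_field (U `&` mdom v.1) (extend v.1 (E v.1)).
  by apply: smooth_field_sub (extend_smooth v.1 _) => q [].
(* Tangent vectors at [v.1] may be compared through their components in the chart at p, as [trans]
   is injective. *)
apply: (can_inj (fun u => transK u vv pv)).
have E1 := nabla_cov oU' sE' sF' Av (conj Uv vv) pv.
rewrite extend_center in E1.
exact: etrans E1 (esym (nabla_cov oU sE sF Av Uv pv)).
Qed.

Lemma nab_vfield_cov v e X : A v -> adapted sigma p v.1 -> smooth_at (hat p X) (zcoord p v) ->
  T v (nab_field nabla v e (vfield L sigma X)) =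
  cov (zcoord p v) (T v e) (fun z => hat p X z *m P z).
Proof.
move=> Av ap sX; have [pv _] := ap; have rv := region_zcoord Av ap.
apply: nab_field_cov => //.
  apply: filterS (region_near rv openT Logic.I) => z [rz _]; by rewrite hat_vfield.
by apply: smooth_mulmx => //; have [] := vproj_at rv.
Qed.

Lemma nab_hfield_cov v e X : A v -> adapted sigma p v.1 -> smooth_at (hat p X) (zcoord p v) ->
  T v (nab_field nabla v e (hfield L sigma X)) =
  cov (zcoord p v) (T v e) (fun z => hat p X z *m Q z).
Proof.
move=> Av ap sX; have [pv _] := ap; have rv := region_zcoord Av ap.
apply: nab_field_cov => //.
  apply: filterS (region_near rv openT Logic.I) => z [rz _]; by rewrite hat_hfield.
by apply: smooth_mulmx => //; apply: smooth_compl; have [] := vproj_at rv.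
Qed.

(** The extension used by [chi] is constant in the chart at [v.1], not in the chart at p;
    tensoriality replaces it by the constant one. *)
Lemma chi_mixed v h e : A v -> adapted sigma p v.1 ->
  T v (chi L sigma nabla v h e) = mixed nabla p P (zcoord p v) (T v h) (fun=> T v e).
Proof.
move=> Av ap; have [pv _] := ap; have rv := region_zcoord Av ap.
have [sP PP] := vproj_at rv; have vv := mdom_center v.1.
have sX := hat_vlift_smooth (mdom_open v.1) (extend_smooth v.1 e) pv vv.
have Xv : hat p (vlift (extend v.1 e)) (zcoord p v) = T v e.
  by rewrite hat_zcoord // /vlift extend_center.
have sc : smooth_at (fun=> T v e) (zcoord p v) by exact: smooth_at_cst.
have E1 := etrans (vpart_chart _ Av ap) (congr1 (mulmx^~ (P (zcoord p v))) (nab_hfield_cov h Av ap sX)).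
have E2 := etrans (hpart_chart _ Av ap) (congr1 (mulmx^~ (Q (zcoord p v))) (nab_vfield_cov h Av ap sX)).
apply: etrans (linearD (T v) _ _) _; apply: etrans (f_equal2 +%R E1 E2) _.
have E3 := mixed_ext nabla p (T v h) sP PP sX sc Xv.
exact: E3.
Qed.

(** T and A are chi on the two parts of h, and [mixed] is additive in its direction. *)
Lemma ONeillTA_mixed v h e : A v -> adapted sigma p v.1 ->
  T v (ONeillTA L sigma nabla v h e) = mixed nabla p P (zcoord p v) (T v h) (fun=> T v e).
Proof.
move=> Av ap.
have E1 := chi_mixed (vpart L sigma v h) e Av ap.
have E2 := chi_mixed (hpart L sigma v h) e Av ap.
have E3 := mixedDa nabla p P (zcoord p v) (T v (vpart L sigma v h)) (T v (hpart L sigma v h)) (fun=> T v e).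
have E4 : T v (vpart L sigma v h) + T v (hpart L sigma v h) = T v h.
  by rewrite -linearD /hpart addrC subrK.
have E5 := congr1 (fun a => mixed nabla p P (zcoord p v) a (fun=> T v e)) E4.
apply: etrans (linearD (T v) _ _) _; apply: etrans (f_equal2 +%R E1 E2) _.
exact: etrans (esym E3) E5.
Qed.

Lemma hat_nabla (U : set M) G F z : open U -> smooth_field U G -> smooth_field U F ->
  region A sigma p z -> U (mpar p z.1) ->
  hat p (nabla G F) z = cov z (hat p (vlift G) z) (hat p (vlift F)).
Proof.
move=> oU sG sF /regionP [v [Av ap -> _]]; have [pv _] := ap.
rewrite /= mchartK // => Uv; rewrite hat_zcoord // (hat_zcoord (vlift G)) //.
exact: nabla_cov oU sG sF Av Uv pv.
Qed.

Lemma region_vlift_smooth (U : set M) F z : open U -> smooth_field U F ->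
  region A sigma p z -> U (mpar p z.1) -> smooth_at (hat p (vlift F)) z.
Proof.
move=> oU sF /regionP [v [Av ap -> _]]; have [pv _] := ap.
by rewrite /= mchartK //; exact: hat_vlift_smooth.
Qed.

Lemma hat_nab_vfield G X z : region A sigma p z -> smooth_at (hat p X) z ->
  hat p (nab_along nabla G (vfield L sigma X)) z =
  cov z (hat p (vlift G) z) (fun z => hat p X z *m P z).
Proof.
move=> /regionP [v [Av ap -> _]] sX; have [pv _] := ap.
rewrite hat_zcoord // (hat_zcoord (vlift G)) //; exact: nab_vfield_cov.
Qed.

Lemma hat_nab_hfield G X z : region A sigma p z -> smooth_at (hat p X) z ->
  hat p (nab_along nabla G (hfield L sigma X)) z =
  cov z (hat p (vlift G) z) (fun z => hat p X z *m Q z).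
Proof.
move=> /regionP [v [Av ap -> _]] sX; have [pv _] := ap.
rewrite hat_zcoord // (hat_zcoord (vlift G)) //; exact: nab_hfield_cov.
Qed.

(** Tensoriality is used in the reverse sense: at each z the constant is replaced by the field F,
    which yields one function of z whose smoothness [mixed_smooth] gives. *)
Lemma hat_ONeillTA G F z : region A sigma p z -> smooth_at (hat p (vlift F)) z ->
  hat p (fun w => ONeillTA L sigma nabla w (G w.1) (F w.1)) z =
  mixed nabla p P z (hat p (vlift G) z) (hat p (vlift F)).
Proof.
move=> rz; have [sP PP] := vproj_at rz.
have [v [Av ap zE _]] := regionP rz; rewrite zE in sP PP * => sF; have [pv _] := ap.
rewrite hat_zcoord // (hat_zcoord (vlift G)) //.
have sc : smooth_at (fun=> T v (F v.1)) (zcoord p v) by exact: smooth_at_cst.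
have E : T v (F v.1) = hat p (vlift F) (zcoord p v) by rewrite hat_zcoord.
exact: etrans (ONeillTA_mixed _ _ Av ap) (mixed_ext nabla p _ sP PP sc sF E).
Qed.

Lemma nab_split (U : set M) v c F : open U -> smooth_field U F -> A v -> U v.1 ->
  adapted sigma p v.1 ->
  nab nabla v c F = vpart L sigma v (nab_field nabla v c (vfield L sigma (vlift F)))
    + hpart L sigma v (nab_field nabla v c (hfield L sigma (vlift F)))
    + ONeillTA L sigma nabla v c (F v.1).
Proof.
move=> oU sF Av Uv ap; have [pv _] := ap; have vv := mdom_center v.1.
have rv := region_zcoord Av ap; have [sP PP] := vproj_at rv.
have sX := hat_vlift_smooth oU sF pv Uv.
have oU' : open (U `&` mdom v.1) by apply: openI => //; exact: mdom_open.
have sF' : smooth_field (U `&` mdom v.1) F by apply: smooth_field_sub sF => q [].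
have sE' : smooth_field (U `&` mdom v.1) (extend v.1 c).
  by apply: smooth_field_sub (extend_smooth v.1 _) => q [].
have E0 := nabla_cov oU' sE' sF' Av (conj Uv vv) pv.
rewrite extend_center in E0.
have E1 := etrans (vpart_chart _ Av ap) (congr1 (mulmx^~ (P (zcoord p v))) (nab_vfield_cov c Av ap sX)).
have E2 := etrans (hpart_chart _ Av ap) (congr1 (mulmx^~ (Q (zcoord p v))) (nab_hfield_cov c Av ap sX)).
have sc : smooth_at (fun=> T v (F v.1)) (zcoord p v) by exact: smooth_at_cst.
have Xv : T v (F v.1) = hat p (vlift F) (zcoord p v) by rewrite hat_zcoord.
have E3 := etrans (ONeillTA_mixed c (F v.1) Av ap) (mixed_ext nabla p (T v c) sP PP sc sX Xv).
have E4 := cov_split nabla p (T v c) sP sX.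
have E5 := f_equal2 +%R (etrans (linearD (T v) _ _) (f_equal2 +%R E1 E2)) E3.
apply: (can_inj (fun u => transK u vv pv)).
exact: etrans E0 (etrans E4 (esym (etrans (linearD (T v) _ _) E5))).
Qed.

(** This is [cov2_split] read back on tangent vectors; each projected or differentiated field has to
    be recognized as its coordinate expression. *)
Lemma nab_nabla_split (U : set M) v e G F : open U -> smooth_field U G -> smooth_field U F ->
  A v -> U v.1 -> adapted sigma p v.1 ->
  nab_field nabla v e (nabla G F) =
    vpart L sigma v (nab_field nabla v e (vfield L sigma (nab_along nabla G (vfield L sigma (vlift F)))))
    + hpart L sigma v (nab_field nabla v e (hfield L sigma (nab_along nabla G (hfield L sigma (vlift F)))))
    + nab_field nabla v e (fun w => ONeillTA L sigma nabla w (G w.1) (F w.1))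
    + (ONeillTA L sigma nabla v e (nabla G F v)
       - ONeillTA L sigma nabla v e (ONeillTA L sigma nabla v (G v.1) (F v.1))).
Proof.
move=> oU sG sF Av Uv ap; have [pv _] := ap; have vv := mdom_center v.1.
have rv := region_zcoord Av ap; have [sP PP] := vproj_at rv; have sQ := smooth_compl sP.
have [Az _] := rv.
have sg := hat_vlift_smooth oU sG pv Uv; have sf := hat_vlift_smooth oU sF pv Uv.
set g := hat p (vlift G) in sg; set f := hat p (vlift F) in sf.
set z0 := zcoord p v in sg sf sP PP sQ Az rv.
have Uz0 : U (mpar p z0.1) by rewrite /= mchartK.
have oA := pF_open LP.
(* The inner fields are differentiated once more, so their coordinate expressions are needed on a
   neighbourhood of z0. *)
have N1 : \forall z \near z0, [/\ region A sigma p z, U (mpar p z.1) & smooth_at f z].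
  apply: filterS (region_near rv oU Uz0) => z [rz Uz]; split => //.
  exact: region_vlift_smooth oU sF rz Uz.
have N2 : \forall z \near z0, [/\ local_tset p A z, smooth_at P z, P z *m P z = P z & smooth_at f z].
  by apply: filterS N1 => z [rz _ sfz]; have [? ?] := vproj_at rz; split => //; case: rz.
have sfP := smooth_mulmx sf sP; have sfQ := smooth_mulmx sf sQ.
have scP := cov_smooth nablaP oA Az sg sfP.
have scQ := cov_smooth nablaP oA Az sg sfQ.
have E0 : T v (nab_field nabla v e (nabla G F)) = cov z0 (T v e) (fun z => cov z (g z) f).
  apply: nab_field_cov => //; last exact: (cov_smooth nablaP oA Az sg sf).
  by apply: filterS N1 => z [rz Uz sfz]; rewrite (hat_nabla oU sG sF).
have E1 : T v (nab_field nabla v e (vfield L sigma (nab_along nabla G (vfield L sigma (vlift F))))) =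
    cov z0 (T v e) (fun z => cov z (g z) (fun z => f z *m P z) *m P z).
  apply: nab_field_cov => //; last exact: smooth_mulmx.
  by apply: filterS N1 => z [rz Uz sfz]; rewrite hat_vfield // hat_nab_vfield.
have E2 : T v (nab_field nabla v e (hfield L sigma (nab_along nabla G (hfield L sigma (vlift F))))) =
    cov z0 (T v e) (fun z => cov z (g z) (fun z => f z *m Q z) *m Q z).
  apply: nab_field_cov => //; last exact: smooth_mulmx.
  by apply: filterS N1 => z [rz Uz sfz]; rewrite hat_hfield // hat_nab_hfield.
have E3 : T v (nab_field nabla v e (fun w => ONeillTA L sigma nabla w (G w.1) (F w.1))) =
    cov z0 (T v e) (fun z => mixed nabla p P z (g z) f).
  apply: nab_field_cov => //; last exact: (mixed_smooth nablaP oA Az sP sg sf).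
  by apply: filterS N1 => z [rz Uz sfz]; rewrite hat_ONeillTA.
have TG : T v (nabla G F v) = cov z0 (g z0) f.
  by rewrite -hat_zcoord // (hat_nabla oU sG sF).
have TA : T v (ONeillTA L sigma nabla v (G v.1) (F v.1)) = mixed nabla p P z0 (g z0) f.
  by rewrite -(hat_ONeillTA G rv sf) hat_zcoord.
have E4 := etrans (ONeillTA_mixed e (nabla G F v) Av ap)
  (congr1 (fun y => mixed nabla p P z0 (T v e) (fun=> y)) TG).
have E5 := etrans (ONeillTA_mixed e (ONeillTA L sigma nabla v (G v.1) (F v.1)) Av ap)
  (congr1 (fun y => mixed nabla p P z0 (T v e) (fun=> y)) TA).
have E6 := cov2_split nablaP oA (T v e) N2 sg.
have E7 := etrans (vpart_chart _ Av ap) (congr1 (mulmx^~ (P z0)) E1).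
have E8 := etrans (hpart_chart _ Av ap) (congr1 (mulmx^~ (Q z0)) E2).
have E9 := etrans (linearD (T v) _ _) (f_equal2 +%R E7 E8).
have E10 := etrans (linearD (T v) _ _) (f_equal2 +%R E9 E3).
have E11 := etrans (linearB (T v) _ _) (f_equal2 (fun x y => x - y) E4 E5).
have E12 := etrans (linearD (T v) _ _) (f_equal2 +%R E10 E11).
apply: (can_inj (fun u => transK u vv pv)).
exact: etrans E0 (etrans E6 (esym E12)).
Qed.

Lemma vpartB v x y : A v -> adapted sigma p v.1 ->
  vpart L sigma v (x - y) = vpart L sigma v x - vpart L sigma v y.
Proof.
move=> Av ap; have [pv _] := ap; have vv := mdom_center v.1.
apply: (can_inj (fun u => transK u vv pv)).
have E := etrans (vpart_chart (x - y) Av ap)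
  (congr1 (mulmx^~ (P (zcoord p v))) (linearB (T v) x y)).
have E' := etrans (linearB (T v) _ _)
  (f_equal2 (fun a b => a - b) (vpart_chart x Av ap) (vpart_chart y Av ap)).
exact: etrans E (etrans (mulmxBl _ _ _) (esym E')).
Qed.

Lemma ONeillTABl v x y e : A v -> adapted sigma p v.1 ->
  ONeillTA L sigma nabla v (x - y) e = ONeillTA L sigma nabla v x e - ONeillTA L sigma nabla v y e.
Proof.
move=> Av ap; have [pv _] := ap; have vv := mdom_center v.1.
have K (a b c : 'rV[R]_n) : c + b = a -> c = a - b by move=> <-; rewrite addrK.
apply: K; apply: (can_inj (fun u => transK u vv pv)).
have E := mixedDa nabla p P (zcoord p v) (T v (x - y)) (T v y) (fun=> T v e).
have E1 : T v (x - y) + T v y = T v x by rewrite -linearD subrK.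
have E2 := congr1 (fun a => mixed nabla p P (zcoord p v) a (fun=> T v e)) E1.
have E3 := etrans (linearD (T v) _ _)
  (f_equal2 +%R (ONeillTA_mixed (x - y) e Av ap) (ONeillTA_mixed y e Av ap)).
exact: etrans E3 (etrans (etrans (esym E) E2) (esym (ONeillTA_mixed x e Av ap))).
Qed.

Lemma hpartB v x y : A v -> adapted sigma p v.1 ->
  hpart L sigma v (x - y) = hpart L sigma v x - hpart L sigma v y.
Proof. by move=> Av ap; rewrite /hpart vpartB // !opprD addrACA. Qed.

End SubmersionChart.

(** The letters a, x belong to nabla_e nabla_H B, the letters b, y to nabla_h nabla_E B, and c, d to
    the bracket. Indices 1, 2 of a, b, c are the vertical and horizontal parts, a3 and b3 the
    derivatives of chi_H B and chi_E B. Further x1 = chi_e (nabla_H B), x2 = chi_e chi_h b, likewise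
    y1, y2 with e and h exchanged, and d1, d2 are chi along nabla_E H and nabla_H E. *)
Lemma split_curvature_algebra (R : realType) n
    (a1 a2 a3 b1 b2 b3 c1 c2 d1 d2 x1 x2 y1 y2 : 'rV[R]_n) :
  (a1 + a2 + a3 + (x1 - x2)) - (b1 + b2 + b3 + (y1 - y2)) - (c1 + c2 + (d1 - d2)) =
  (a1 - b1 - c1) + (a2 - b2 - c2) + (a3 - d1 - y1) - (b3 - d2 - x1) + y2 - x2.
Proof. by apply/rowP => k; rewrite !mxE; ring. Qed.

Theorem theorem1 (R : realType) (n m : nat) (M : manifold R n) (N : manifold R m)
    (A : set (tangent M)) (L : tangent M -> R)
    (A' : set (tangent N)) (L' : tangent N -> R)
    (sigma : M -> N) (nabla : connection M)
    (Hsub : pseudo_Finsler_submersion A L A' L' sigma)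
    (Hvert : forall v, A v ->
       nondegenerate_on (vertical sigma v.1) (fundamental L v))
    (Hnabla : Levi_Civita_Chern A L nabla)
    (v : tangent M) (Av : A v) (e h b : 'rV[R]_n)
    (U : set M) (E H B : M -> 'rV[R]_n)
    (openU : open U) (Uv : U v.1)
    (smoothE : smooth_field U E) (smoothH : smooth_field U H)
    (smoothB : smooth_field U B)
    (Ee : E v.1 = e) (Hh : H v.1 = h) (Bb : B v.1 = b) :
  let TA := ONeillTA L sigma nabla in
  curvature nabla E H B v =
    vcurvature L sigma nabla E H B v + hcurvature L sigma nabla E H B v
    + nab_tensor nabla TA v e H B - nab_tensor nabla TA v h E B
    + TA v h (TA v e b) - TA v e (TA v h b).
Proof.
move=> TA; subst e h b.
have LP := ps_total Hsub; have sigmaP := ps_smooth Hsub.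
have dsigma_surj := ps_dsurjective Hsub; have nablaP := LCC_connection Hnabla.
have ap : adapted sigma v.1 v.1 := adapted_center sigma v.1.
have vv := mdom_center v.1.
have S1 := nab_nabla_split LP sigmaP dsigma_surj Hvert nablaP (E v.1) openU smoothH smoothB Av Uv ap.
have S2 := nab_nabla_split LP sigmaP dsigma_surj Hvert nablaP (H v.1) openU smoothE smoothB Av Uv ap.
have S3 := nab_split LP sigmaP dsigma_surj Hvert nablaP (bracket E H v.1) openU smoothB Av Uv ap.
(* Vanishing torsion splits the bracket into the two directions that the product rules for the
   derivatives of [TA] subtract. *)
have D : TA v (bracket E H v.1) (B v.1) = TA v (nabla E H v) (B v.1) - TA v (nabla H E v) (B v.1).
  rewrite -(LCC_torsion_free Hnabla openU smoothE smoothH Av Uv).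
  have D := ONeillTABl LP sigmaP dsigma_surj Hvert nablaP (nabla E H v) (nabla H E v) (B v.1) Av ap.
  exact: D.
(* [nab_tensor] uses [nab] with the vectors e, h, while the expansions contain [nabla] with the
   fields E, H. *)
have EH := nab_nabla nablaP openU smoothE smoothH Av Uv vv.
have HE := nab_nabla nablaP openU smoothH smoothE Av Uv vv.
have EB := nab_nabla nablaP openU smoothE smoothB Av Uv vv.
have HB := nab_nabla nablaP openU smoothH smoothB Av Uv vv.
have vB x y : vpart L sigma v (x - y) = vpart L sigma v x - vpart L sigma v y.
  have E1 := vpartB LP sigmaP dsigma_surj Hvert x y Av ap; exact: E1.
have hB x y : hpart L sigma v (x - y) = hpart L sigma v x - hpart L sigma v y.
  have E1 := hpartB LP sigmaP dsigma_surj Hvert x y Av ap; exact: E1.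
have lhs := f_equal2 (fun x y => x - y) (f_equal2 (fun x y => x - y) S1 S2)
  (etrans S3 (congr1 (fun x => _ + x) D)).
apply: etrans lhs _.
apply: etrans (split_curvature_algebra _ _ _ _ _ _ _ _ _ _ _ _ _ _) _.
(* [vcurvature] and [hcurvature] project the whole combination, the expansions project term by
   term. *)
have v3 x y z : vpart L sigma v (x - y - z) = vpart L sigma v x - vpart L sigma v y - vpart L sigma v z.
  by rewrite !vB.
have h3 x y z : hpart L sigma v (x - y - z) = hpart L sigma v x - hpart L sigma v y - hpart L sigma v z.
  by rewrite !hB.
have e1 : vcurvature L sigma nabla E H B v = _ := v3 _ _ _.
have e2 : hcurvature L sigma nabla E H B v = _ := h3 _ _ _.
have e3 := f_equal2 (fun x y => nab_field nabla v (E v.1) (fun w => TA w (H w.1) (B w.1))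
  - TA v x (B v.1) - TA v (H v.1) y) EH EB.
have e4 := f_equal2 (fun x y => nab_field nabla v (H v.1) (fun w => TA w (E w.1) (B w.1))
  - TA v x (B v.1) - TA v (E v.1) y) HE HB.
have e5 := f_equal2 (fun x y => x - y) (f_equal2 +%R (f_equal2 +%R e1 e2) e3) e4.
have e6 := congr1 (fun x => x + TA v (H v.1) (TA v (E v.1) (B v.1))
  - TA v (E v.1) (TA v (H v.1) (B v.1))) e5.
exact: esym e6.
Qed.
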